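(* Let $\rho$ be an invariant Vishik-Fursikov measure on $\mathcal{C}_{\mathrm{w}}=\mathcal{C}_{\mathrm{loc}}([0,\infty),H_{\mathrm{w}})$ for the three-dimensional incompressible Navier-Stokes equations, and let $\Phi:H\to\mathbb{R}$ be a bounded Borel-measurable function. Then, for $\rho$-almost every Leray-Hopf weak solution $\mathbf{u}$ on $[0,\infty)$, the classical limit $$\lim_{T\to\infty}\frac{1}{T}\int_0^T \Phi(\mathbf{u}(t))\,\mathrm{d}t$$ exists. In particular, if $\rho_0=\Pi_0\rho$ is the associated Vishik-Fursikov stationary statistical solution, then for $\rho_0$-almost every initial condition $\mathbf{u}_0$ in $H$ there exists at least one Leray-Hopf weak solution $\mathbf{u}$ on $[0,\infty)$ with $\mathbf{u}(0)=\mathbf{u}_0$ for which the limit $\lim_{T\to\infty}\frac{1}{T}\int_0^T \Phi(\mathbf{u}(t))\,\mathrm{d}t$ exists.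
   Context: Setting. Let $\Omega\subset\mathbb{R}^3$ be a bounded domain with smooth boundary $\partial\Omega$, let $\nu>0$, and let $\mathbf{f}\in H$ be time-independent, with $H$ defined below. The incompressible Navier-Stokes equations for the velocity $\mathbf{u}=\mathbf{u}(t,\mathbf{x})$ and pressure $p=p(t,\mathbf{x})$ are $$\frac{\partial\mathbf{u}}{\partial t}-\nu\Delta\mathbf{u}+(\mathbf{u}\cdot\nabla)\mathbf{u}+\nabla p=\mathbf{f},\qquad \nabla\cdot\mathbf{u}=0\quad\text{on }(0,\infty)\times\Omega,\qquad \mathbf{u}=0\quad\text{on }(0,\infty)\times\partial\Omega.$$ Spaces. $H$ (resp. $V$) is the closure in $L^2(\Omega)^3$ (resp. in $H_0^1(\Omega)^3$) of the space of infinitely differentiable divergence-free vector fields with compact support in $\Omega$, with the inherited inner product. $H_{\mathrm{w}}$ is $H$ endowed with its weak topology; the Borel $\sigma$-algebras of $H$ and $H_{\mathrm{w}}$ coincide. $\mathcal{C}_{\mathrm{w}}=\mathcal{C}_{\mathrm{loc}}([0,\infty),H_{\mathrm{w}})$ is the space of continuous functions from $[0,\infty)$ into $H_{\mathrm{w}}$, endowed with the topology of uniform convergence on compact subintervals of $[0,\infty)$ with values in $H_{\mathrm{w}}$. Leray-Hopf weak solutions. A Leray-Hopf weak solution on $[0,\infty)$ is a function $\mathbf{u}\in L^\infty_{\mathrm{loc}}(0,\infty;H)\cap L^2_{\mathrm{loc}}(0,\infty;V)$ that satisfies the equations in the weak sense, i.e. for every $\mathbf{v}\in V$, $$\frac{\mathrm{d}}{\mathrm{d}t}(\mathbf{u},\mathbf{v})_{L^2}+\nu(\nabla\mathbf{u},\nabla\mathbf{v})_{L^2}+((\mathbf{u}\cdot\nabla)\mathbf{u},\mathbf{v})_{L^2}=(\mathbf{f},\mathbf{v})_{L^2}$$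 in the sense of distributions in time; is strongly continuous in $H$ from the right at $t=0$; and satisfies the energy inequality $$\frac12\frac{\mathrm{d}}{\mathrm{d}t}\|\mathbf{u}\|_{L^2}^2+\nu\|\nabla\mathbf{u}\|_{L^2}^2\le(\mathbf{f},\mathbf{u})_{L^2}$$ in the distribution sense on $[0,\infty)$. Such a solution belongs to $\mathcal{C}_{\mathrm{w}}$. Let $\mathcal{U}\subset\mathcal{C}_{\mathrm{w}}$ be the set of Leray-Hopf weak solutions on $[0,\infty)$; it is a Borel subset of $\mathcal{C}_{\mathrm{w}}$. Operators. $\Pi_0:\mathcal{C}_{\mathrm{w}}\to H_{\mathrm{w}}$, $\Pi_0\mathbf{u}=\mathbf{u}(0)$. For $\tau\ge0$, $\sigma_\tau:\mathcal{C}_{\mathrm{w}}\to\mathcal{C}_{\mathrm{w}}$, $(\sigma_\tau\mathbf{u})(t)=\mathbf{u}(t+\tau)$ for all $t\ge0$. Measures. An invariant (space-time) Vishik-Fursikov measure is a Borel probability measure $\rho$ on $\mathcal{C}_{\mathrm{w}}$ such that $\rho(\mathcal{U})=1$ and $\rho(\sigma_\tau^{-1}\mathcal{E})=\rho(\mathcal{E})$ for every $\tau\ge0$ and every Borel set $\mathcal{E}\subset\mathcal{C}_{\mathrm{w}}$. The push-forward $\rho_0=\Pi_0\rho$, i.e. $\rho_0(E)=\rho(\Pi_0^{-1}E)$ for Borel $E\subset H$, is a Borel probability measure on $H$, called the associated Vishik-Fursikov stationary statistical solution. *)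

(* Defs.v *)
From HB Require Import structures.
From mathcomp Require Import all_boot all_order all_algebra.
From mathcomp Require Import all_classical all_reals all_analysis.
From mathcomp Require Import measurable_realfun.

Set Implicit Arguments.
Unset Strict Implicit.
Unset Printing Implicit Defensive.

Import Order.TTheory GRing.Theory Num.Theory.
Import numFieldNormedType.Exports.

Local Open Scope classical_set_scope.
Local Open Scope ring_scope.

(** Calculus on R^3, whose carrier is the triple product [R * R * R]; the
    spatial coordinates are indexed by ['I_3]. *)

Section Space.
Variable R : realType.
Local Notation R3 := (R * R * R)%type.
Local Notation mR3 :=
  (measurableTypeR R * measurableTypeR R * measurableTypeR R)%type.

Definition lebesgue3 :=
  ((@lebesgue_measure R \x @lebesgue_measure R) \x @lebesgue_measure R)%E.

Definition basis3 (j : 'I_3) : R3 :=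
  ((j == 0%N :> nat)%:R, (j == 1%N :> nat)%:R, (j == 2%N :> nat)%:R).

Definition partial (j : 'I_3) (f : R3 -> R) (x : R3) : R := 'D_(basis3 j) f x.

Fixpoint class_C (k : nat) (f : R3 -> R) : Prop :=
  match k with
  | 0%N => continuous f
  | m.+1 => [/\ continuous f, (forall j x, derivable f x (basis3 j))
              & (forall j, class_C m (partial j f))]
  end.

Definition smooth (f : R3 -> R) := forall k, class_C k f.

(* Near each boundary point, the set is the sublevel set {g < 0} of a smooth
   function with nonvanishing gradient, hence lies on one side of its smooth
   boundary. *)
Definition smooth_boundary (A : set R3) := forall x,
  (closure A `\` A^°) x ->
  exists U : set R3, exists g : R3 -> R,
    [/\ open_nbhs x U, smooth g, (exists j, partial j g x != 0)
      & A `&` U = [set y | g y < 0] `&` U].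

Record bounded_smooth_domain := BoundedSmoothDomain {
  dom :> set R3;
  dom_open : open dom;
  dom_connected : connected dom;
  dom_nonempty : dom !=set0;
  dom_bounded : bounded_set dom;
  dom_smooth : smooth_boundary dom }.

Lemma open_measurable3 (A : set R3) : open A -> measurable (A : set mR3).
Proof.
move=> oA.
pose box (p : rat * rat * rat * nat) : set R3 :=
  (ball (ratr p.1.1.1 : R) p.2.+1%:R^-1 `*` ball (ratr p.1.1.2 : R) p.2.+1%:R^-1)
    `*` ball (ratr p.1.2 : R) p.2.+1%:R^-1.
have -> : A = \bigcup_(p in [set p | box p `<=` A]) box p.
  rewrite eqEsubset; split; last by move=> x [p /= pA]; exact: pA.
  move=> x Ax.
  have : nbhs x A by apply: open_nbhs_nbhs.
  move=> /nbhs_ballP[e /= e0 eA].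
  have e20 : 0 < e / 2 by rewrite divr_gt0.
  pose n := Num.trunc (e / 2)^-1.
  have ne : n.+1%:R^-1 < e / 2.
    by rewrite -[ltRHS]invrK ltf_pV2 ?posrE ?ltr0Sn ?invr_gt0// truncnS_gt.
  have n0 : 0 < n.+1%:R^-1 :> R by rewrite invr_gt0.
  have ex (y : R) : exists q : rat, ball y n.+1%:R^-1 (ratr q).
    have : open_nbhs y (ball y n.+1%:R^-1 : set R).
      by split; [exact: ball_open|exact: ballxx].
    move=> [oy yy]; have [] := @dense_rat R (ball y n.+1%:R^-1 : set R) _ oy.
      by exists y.
    by move=> z [yz [q _ qz]]; exists q; rewrite qz.
  have [q1 h1] := ex x.1.1; have [q2 h2] := ex x.1.2; have [q3 h3] := ex x.2.
  exists (q1, q2, q3, n) => /=; last first.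
    by split; [split|]; exact: ball_sym.
  move=> y [[/= y1 y2] y3]; apply: eA.
  have H (a b c : R) : ball a n.+1%:R^-1 b -> ball b n.+1%:R^-1 c -> ball a e c.
    move=> ab bc; apply: (@le_ball _ _ _ (n.+1%:R^-1 + n.+1%:R^-1)).
      by rewrite [leRHS]splitr lerD// ltW.
    exact: ball_triangle ab bc.
  by split; [split|]; [exact: H h1 y1|exact: H h2 y2|exact: H h3 y3].
rewrite bigcup_mkcond; apply: countable_bigcupT_measurable => // p.
case: ifP => _ //; apply: measurableX; first apply: measurableX;
  exact: measurable_ball.
Qed.

Lemma measurable_dom (D : bounded_smooth_domain) : measurable (dom D : set mR3).
Proof. by apply: open_measurable3; exact: dom_open. Qed.
End Space.

Section FunctionSpaces.
Variables (R : realType) (D : bounded_smooth_domain R).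
Local Notation R3 := (R * R * R)%type.
Local Notation mR3 :=
  (measurableTypeR R * measurableTypeR R * measurableTypeR R)%type.

Definition lebesgue_dom : {measure set mR3 -> \bar R} :=
  mrestr (@lebesgue3 R) (measurable_dom D).
Local Notation mu := lebesgue_dom.

Definition test_function (phi : R3 -> R) := smooth phi /\
  exists K : set R3, [/\ compact K, K `<=` D & forall x, ~ K x -> phi x = 0].

Definition solenoidal_test (phi : 'I_3 -> R3 -> R) :=
  (forall i, test_function (phi i)) /\
  (forall x, \sum_(i < 3) partial i (phi i) x = 0).

Definition is_weak_partial (j : 'I_3) (g w : R3 -> R) :=
  (w : mR3 -> R) \in Lfun mu 2%:R%:E /\
  forall phi, test_function phi ->
    \int[mu]_x (g x * partial j phi x) = - \int[mu]_x (w x * phi x).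

(* The weak derivative, unique up to a null set, or 0 if there is none. *)
Definition weak_partial (j : 'I_3) (g : R3 -> R) : R3 -> R :=
  xget (cst 0) [set w | is_weak_partial j g w].

Definition L2_sqdist (g h : R3 -> R) : R := \int[mu]_x ((g x - h x) ^+ 2).

(* For a test function the weak and the classical derivatives agree a.e., so
   this is also the squared H^1 distance from an element of H^1 to a test
   function. *)
Definition H1_sqdist (g h : R3 -> R) : R :=
  L2_sqdist g h +
  \sum_(j < 3) L2_sqdist (weak_partial j g) (weak_partial j h).

Definition L2 : Type := LspaceType2 mu.
HB.instance Definition _ := gen_eqMixin L2.
HB.instance Definition _ := gen_choiceMixin L2.

Let mfun0 : {mfun mR3 >-> measurableTypeR R} := cst 0.
Definition L2_zero_class : {mfun_ mu, mR3 >-> measurableTypeR R} :=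
  \pi_({mfun_ mu, mR3 >-> measurableTypeR R})%qT mfun0.

Lemma L2_zero_ae : (L2_zero_class : mR3 -> R) = cst 0 %[ae mu].
Proof.
suff : ae_eq_op mu (repr L2_zero_class) mfun0 by move=> /asboolP.
by rewrite -eqmodE; apply/eqP; rewrite reprK.
Qed.

Lemma L2_zero_finite : finite_norm mu 2%:R%:E (L2_zero_class : mR3 -> R).
Proof.
rewrite /finite_norm unlock /Lnorm/=.
rewrite [X in (X `^ _)%E](_ : _ = 0%E).
  by rewrite poweR0r ?ltry// invr_eq0.
rewrite (ae_eq_integral (cst 0%E)) ?integral0//.
- apply/measurable_EFinP.
  apply: (measurableT_comp (measurable_powR _)) => //.
  exact: measurableT_comp.
- apply: filterS L2_zero_ae => x /= + _ => /(_ I) ->.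
  by rewrite normr0 powR0.
Qed.
HB.instance Definition _ := isFinLebesgue.Build _ _ _ mu 2%:R%:E (lee1n 2)
  L2_zero_class L2_zero_finite.

Definition L2_zero : L2 := L2_zero_class.

Lemma smooth0 : smooth (cst 0 : R3 -> R).
Proof.
elim=> [|k IH] /=; first exact: cst_continuous.
split; [exact: cst_continuous|by move=> j x; exact: derivable_cst|move=> j].
by rewrite (_ : partial j _ = cst 0)//; apply/funext => x; exact: derive_cst.
Qed.

Lemma solenoidal_test0 : solenoidal_test (fun=> cst 0).
Proof.
split=> [i|x]; last by rewrite big1// => i _; exact: derive_cst.
by split; [exact: smooth0|exists set0; split => //; exact: compact0].
Qed.

Definition field := 'I_3 -> L2.

Record H := MkH {
  H_field :> field;
  H_closure : forall e, 0 < e -> exists2 phi, solenoidal_test phi &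
    \sum_(i < 3) L2_sqdist (H_field i) (phi i) < e }.

HB.instance Definition _ := gen_eqMixin H.
HB.instance Definition _ := gen_choiceMixin H.

Lemma H_zero_closure e : 0 < e -> exists2 phi, solenoidal_test phi &
  \sum_(i < 3) L2_sqdist L2_zero (phi i) < e.
Proof.
move=> e0; exists (fun=> cst 0); first exact: solenoidal_test0.
rewrite big1// => i _; rewrite /L2_sqdist /Rintegral.
rewrite (ae_eq_integral (cst 0%E)) ?integral0//.
- apply/measurable_EFinP/measurable_funX/measurable_funB => //.
  exact: (@measurable_funPT _ _ _ _ (repr L2_zero_class)).
- apply: filterS L2_zero_ae => x /= + _ => /(_ I) h.
  by rewrite h subrr expr0n.
Qed.
HB.instance Definition _ := isPointed.Build H
  (MkH (H_field := fun=> L2_zero) H_zero_closure).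

Definition inH1 (g : L2) := forall j, exists w, is_weak_partial j g w.

Definition inH10 (g : L2) := inH1 g /\
  forall e, 0 < e -> exists2 phi, test_function phi & H1_sqdist g phi < e.

Definition inV (u : field) := (forall i, inH10 (u i)) /\
  forall e, 0 < e -> exists2 phi, solenoidal_test phi &
    \sum_(i < 3) H1_sqdist (u i) (phi i) < e.

Definition L2_inner (u v : field) : R :=
  \sum_(i < 3) \int[mu]_x (u i x * v i x).

Definition L2_sqnorm (u : field) : R := L2_inner u u.

Definition grad_inner (u v : field) : R :=
  \sum_(i < 3) \sum_(j < 3)
    \int[mu]_x (weak_partial j (u i) x * weak_partial j (v i) x).

Definition grad_sqnorm (u : field) : R := grad_inner u u.

(* The inertial term ((u . grad) u, v). *)
Definition inertial (u v : field) : R :=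
  \sum_(i < 3) \sum_(j < 3)
    \int[mu]_x (u j x * weak_partial j (u i) x * v i x).

Definition L2_dist (u v : field) : R :=
  Num.sqrt (\sum_(i < 3) L2_sqdist (u i) (v i)).

Definition V_dist (u v : field) : R :=
  Num.sqrt (\sum_(i < 3) H1_sqdist (u i) (v i)).

Definition H_open : set (set H) := [set A | forall u : H, A u ->
  exists2 r, 0 < r & [set v : H | L2_dist u v < r] `<=` A].

Definition borelH := g_sigma_algebraType H_open.

Definition H_pairing (u : H) : {ptws H -> R} := fun v => L2_inner u v.

(* H with its weak topology: by the Riesz representation theorem this is the
   coarsest topology making all the functionals (., v), v in H, continuous. *)
Definition Hw := initial_topology H_pairing.

End FunctionSpaces.

Section Trajectories.
Variables (R : realType) (D : bounded_smooth_domain R).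

Definition halfline : Type := set_type [set t : R | 0 <= t].

Lemma time_ge0 (t : R) : Num.max t 0 \in [set t : R | 0 <= t].
Proof. by rewrite inE /= le_max lexx orbT. Qed.

Definition time (t : R) : halfline := exist _ (Num.max t 0) (time_ge0 t).

Definition compact_itvs : set (set halfline) :=
  [set A | exists a b : R, A = [set t | a <= val t <= b]].

HB.instance Definition _ :=
  Topological.copy halfline (set_type [set t : R | 0 <= t]).

Definition Cw_incl (u : continuousType halfline (Hw D)) :
  {family compact_itvs, halfline -> Hw D} := u.

Definition mk_Cw (u : halfline -> Hw D) (cu : continuous u) :
    continuousType halfline (Hw D) :=
  HB.pack u (isContinuous.Build _ _ u cu).

HB.instance Definition _ := isPointed.Build (continuousType halfline (Hw D))
  (mk_Cw (@cst_continuous halfline (Hw D) (point : H D))).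

Definition Cw := initial_topology Cw_incl.

Definition borelCw := g_sigma_algebraType (@open Cw).

Definition at_time (u : Cw) (t : R) : H D :=
  (u : continuousType halfline (Hw D)) (time t).

Definition Pi0 (u : borelCw) : borelH D := at_time u 0.

Lemma shift_continuous (tau : R) (u : Cw) :
  continuous (fun t : halfline =>
    (u : continuousType halfline (Hw D)) (time (val t + tau))).
Proof.
have ct : continuous (fun s : halfline => time (val s + tau)).
  apply: continuous_comp_initial => t.
  rewrite (_ : _ \o _ = fun s : halfline => Num.max (val s + tau) 0)//.
  apply: (@continuous_max _ _ (fun s : halfline => val s + tau) (cst 0)).
    apply: (@continuousD _ _ _ (fun s : halfline => val s : R) (cst tau)).
      exact: initial_continuous.
    exact: cst_continuous.
  exact: cst_continuous.
move=> t; apply: (@continuous_comp _ _ _ (fun s : halfline => time (val s + tau))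
   (u : continuousType halfline (Hw D))); first exact: ct.
exact: cts_fun.
Qed.

(* The time shift sigma_tau, meant for [0 <= tau]. *)
Definition shift (tau : R) (u : borelCw) : borelCw :=
  mk_Cw (@shift_continuous tau u).

End Trajectories.

Section LerayHopf.
Variables (R : realType) (D : bounded_smooth_domain R) (nu : R) (f : H D).
Local Notation leb := (@lebesgue_measure R).

(* Distributions in time are tested on smooth functions with compact support
   in the open half-line. *)
Definition time_test (psi : R -> R) :=
  (forall n t, derivable (derive1n n psi) t 1) /\
  exists a b : R, 0 < a /\ forall t, ~~ (a <= t <= b) -> psi t = 0.

(* Strong measurability into H follows from weak continuity. *)
Definition Linfty_loc_H (u : Cw D) := forall a b : R, 0 < a ->
  exists M : R,
    {ae leb, forall t, a <= t <= b -> Num.sqrt (L2_sqnorm (at_time u t)) <= M}.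

(* Measurability into the separable space V is tested on open balls. *)
Definition L2_loc_V (u : Cw D) :=
  [/\ {ae leb, forall t, 0 < t -> inV (at_time u t)},
      (forall (w : field D) (r : R), inV w ->
        measurable ([set t | [/\ 0 < t, inV (at_time u t)
                              & V_dist (at_time u t) w < r]]
                    : set (measurableTypeR R)))
    & forall a b : R, 0 < a ->
        (\int[leb]_(t in `[a, b])
          (L2_sqnorm (at_time u t) + grad_sqnorm (at_time u t))%:E < +oo)%E].

Definition weak_equation (u : Cw D) :=
  forall v : field D, inV v -> forall psi, time_test psi ->
    - (\int[leb]_(t in `]0, +oo[) (derive1 psi t * L2_inner (at_time u t) v))
    + nu * (\int[leb]_(t in `]0, +oo[) (psi t * grad_inner (at_time u t) v))
    + \int[leb]_(t in `]0, +oo[) (psi t * inertial (at_time u t) v)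
    = \int[leb]_(t in `]0, +oo[) (psi t * L2_inner f v).

Definition energy_inequality (u : Cw D) :=
  forall psi, time_test psi -> (forall t, 0 <= psi t) ->
    - (2^-1 * \int[leb]_(t in `]0, +oo[) (derive1 psi t * L2_sqnorm (at_time u t)))
    + nu * (\int[leb]_(t in `]0, +oo[) (psi t * grad_sqnorm (at_time u t)))
    <= \int[leb]_(t in `]0, +oo[) (psi t * L2_inner f (at_time u t)).

Definition leray_hopf (u : Cw D) :=
  [/\ Linfty_loc_H u, L2_loc_V u, weak_equation u,
      L2_dist (at_time u t) (at_time u 0) @[t --> 0^'+] --> (0 : R)
    & energy_inequality u].

(* As the set U of Leray-Hopf weak solutions is Borel, [rho U = 1] amounts to
   the complement of U being rho-negligible; the latter does not depend on the
   values of rho outside the sigma-algebra. *)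
Definition invariant_vishik_fursikov (rho : probability (borelCw D) R) :=
  {ae rho, forall u, leray_hopf u} /\
  forall tau : R, 0 <= tau -> forall A : set (borelCw D), measurable A ->
    rho (shift tau @^-1` A) = rho A.

Definition stationary_solution (rho : probability (borelCw D) R) :
    set (borelH D) -> \bar R :=
  pushforward rho (@Pi0 R D).

Definition time_average_converges (Phi : H D -> R) (u : Cw D) :=
  cvg (T^-1 * (\int[leb]_(t in `[0, T]) Phi (at_time u t)) @[T --> +oo]).

End LerayHopf.

(* Main.v *)
From HB Require Import structures.
Require Import Defs.
From mathcomp Require Import all_boot all_order all_algebra.
From mathcomp Require Import all_classical all_reals all_analysis.
From mathcomp Require Import measurable_realfun ring lra.
From mathcomp Require finmap.

(** The first claim is Birkhoff's ergodic theorem ([birkhoff]) for the shift by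
    one unit of time, applied to the observable
    [F u = \int_0^1 Phi (u t) dt] ([unit_average]): its ergodic sums are the
    integrals of [Phi (u t)] over [[0, n]], and since [Phi] is bounded the limit
    along integers is a limit along all times.  The point to check is that [F] is
    measurable, although trajectories are only weakly continuous while [Phi] is
    Borel for the norm.  The space [H] is separable, so every norm-open set is a
    countable union of closed balls, and each closed ball is cut out by countably
    many weakly continuous functionals; this makes [(t, u) |-> u t] jointly
    measurable ([measurable_at_time]).

    The second claim is not a formal consequence of the first: the trajectories
    with convergent averages contain a Borel set [G] of full measure, but the set
    of their initial values is merely a continuous image of [G], and one needs a
    Borel subset of it of full measure.  It is enough to exhaust [G], up to a
    null set, by countably many compact sets of trajectories: evaluation at time 0
    sends a compact set to a weakly compact, hence weakly closed, hence Borel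
    subset of [H] ([ae_initial_value]).

    Such an exhaustion is inner regularity of [rho].  For a topological space
    with countably many continuous functions separating the points it follows
    from tightness ([borel_inner_compact]).  Tightness comes from the theorem of
    Arzela and Ascoli ([compact_controlled_traj]): prescribing a bound of the norm
    on every [[0, n]] and a modulus of continuity of the coordinates [(u, e_k)]
    along a dense sequence [e] gives a compact set of trajectories, because balls
    of [H] are weakly compact ([weak_ball_ultra_cvg]).  Each of these countably
    many constraints holds with probability as close to 1 as desired, since a
    trajectory is weakly continuous and a Leray-Hopf solution is bounded on bounded
    time intervals ([leray_hopf_bounded]).  Weak compactness of balls rests on the
    Riesz representation theorem, hence on the completeness of [H] ([H_complete]);
    the dense sequence is provided by [H_separable]. *)

Set Implicit Arguments.
Unset Strict Implicit.
Unset Printing Implicit Defensive.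
Import Order.TTheory GRing.Theory Num.Theory.
Import numFieldNormedType.Exports.

Local Open Scope classical_set_scope.
Local Open Scope ring_scope.

(** * Birkhoff's pointwise ergodic theorem *)

Lemma decreasing_probability_small {d} {T : measurableType d} {R : realType}
    (P : probability T R) (A : nat -> set T) (e : R) :
  (forall n, measurable (A n)) -> (forall n, A n.+1 `<=` A n) ->
  P (\bigcap_n A n) = 0%E -> 0 < e -> exists n, (P (A n) < e%:E)%E.
Proof.
move=> mA decA A0 e0.
have : P (A n) @[n --> \oo] --> P (\bigcap_n A n).
  apply: nonincreasing_cvg_mu => //.
  - by apply: le_lt_trans (probability_le1 _ _) (ltry _).
  - exact: bigcap_measurable.
  - by apply/nonincreasing_seqP => n; apply/subsetPset; exact: decA.
rewrite A0 => /fine_cvg /cvgr_lt /(_ _ e0) [N _ hN].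
exists N; rewrite -(@fineK _ (P (A N))) ?lte_fin; last exact: fin_num_measure.
exact: hN (leqnn N).
Qed.

Section BoundedMeasurable.
Context {d} {T : measurableType d} {R : realType} (P : probability T R).

Definition bounded_measurable (h : T -> R) :=
  measurable_fun setT h /\ exists C, forall x, `|h x| <= C.

Lemma bounded_measurable_integrable h :
  bounded_measurable h -> P.-integrable setT (EFin \o h).
Proof.
move=> [mh [C hC]]; apply: measurable_bounded_integrable => //.
  by rewrite (le_lt_trans (probability_le1 P measurableT))// ltry.
exists C; split; first exact: num_real.
by move=> M CM x _; apply: le_trans (hC x) (ltW CM).
Qed.

Lemma bounded_measurable_cst c : bounded_measurable (cst c).
Proof. by split=> //; exists `|c|. Qed.

Lemma bounded_measurableN h :
  bounded_measurable h -> bounded_measurable (fun x => - h x).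
Proof.
move=> [mh [C hC]]; split; first exact: measurable_funN.
by exists C => x; rewrite normrN.
Qed.

Lemma bounded_measurableD g h : bounded_measurable g -> bounded_measurable h ->
  bounded_measurable (fun x => g x + h x).
Proof.
move=> [mg [C gC]] [mh [C' hC]]; split; first exact: measurable_funD.
by exists (C + C') => x; rewrite (le_trans (ler_normD _ _))// lerD.
Qed.

Lemma bounded_measurableB g h : bounded_measurable g -> bounded_measurable h ->
  bounded_measurable (fun x => g x - h x).
Proof.
by move=> bg bh; apply: bounded_measurableD => //; exact: bounded_measurableN.
Qed.

Lemma bounded_measurableM g h : bounded_measurable g -> bounded_measurable h ->
  bounded_measurable (fun x => g x * h x).
Proof.
move=> [mg [C gC]] [mh [C' hC]]; split; first exact: measurable_funM.
by exists (C * C') => x; rewrite normrM ler_pM.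
Qed.

Lemma bounded_measurable_indic A : measurable A ->
  bounded_measurable (\1_A : T -> R).
Proof.
move=> mA; split; first exact: measurable_indic.
by exists 1 => x; rewrite indicE; case: (x \in A); rewrite ?normr1 ?normr0.
Qed.

Lemma bounded_measurable_comp h (S : T -> T) : measurable_fun setT S ->
  bounded_measurable h -> bounded_measurable (fun x => h (S x)).
Proof.
move=> mS [mh [C hC]]; split; first exact: measurableT_comp.
by exists C => x; exact: hC.
Qed.

Lemma bounded_measurable_max0 h : bounded_measurable h ->
  bounded_measurable (fun x => Num.max 0 (h x)).
Proof.
move=> [mh [C hC]]; split; first exact: measurable_maxr.
exists C => x; rewrite ger0_norm ?le_max ?lexx// ge_max.
by rewrite (le_trans _ (hC x))//= (le_trans _ (hC x))// ler_norm.
Qed.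

End BoundedMeasurable.

Section Birkhoff.
Context {d} {T : measurableType d} {R : realType} (P : probability T R).
Variable S : T -> T.
Hypothesis mS : measurable_fun setT S.
Hypothesis PS : forall A, measurable A -> P (S @^-1` A) = P A.
Implicit Types (g f : T -> R) (B : set T).

Definition ergodic_sum g n x := \sum_(i < n) g (iter i S x).

Lemma ergodic_sumS g n x :
  ergodic_sum g n.+1 x = g x + ergodic_sum g n (S x).
Proof.
rewrite /ergodic_sum big_ord_recl /=; congr (_ + _).
by apply: eq_bigr => i _; rewrite /= -iterSr.
Qed.

Lemma measurable_iter i : measurable_fun setT (iter i S).
Proof.
elim: i => [|i IH]; first exact: measurable_id.
by rewrite (_ : iter _ _ = S \o iter i S)//; exact: measurableT_comp.
Qed.

Lemma measurable_ergodic_sum g n : measurable_fun setT g ->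
  measurable_fun setT (ergodic_sum g n).
Proof.
move=> mg; rewrite /ergodic_sum; apply: measurable_sum => i.
by apply: measurableT_comp => //; exact: measurable_iter.
Qed.

Lemma Rintegral_invariant h : bounded_measurable h ->
  \int[P]_x h (S x) = \int[P]_x h x.
Proof.
move=> bh; rewrite /Rintegral; congr fine.
have mh : measurable_fun setT (EFin \o h) by apply/measurable_EFinP; case: bh.
have := @integral_pushforward _ _ _ _ R S mS P setT (EFin \o h) mh.
move=> /(_ (bounded_measurable_integrable _ (bounded_measurable_comp mS bh))).
move=> /(_ measurableT); rewrite preimage_setT => <-.
by apply: eq_measure_integral => A mA _; exact: PS.
Qed.

(** The maximum of [0] and of the ergodic sums of [g] up to [n] terms,
    defined by the recursion that these sums satisfy along the orbit. *)
Fixpoint running_max g n x : R :=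
  if n is m.+1 then Num.max 0 (g x + running_max g m (S x)) else 0.

Lemma running_max_ge0 g n x : 0 <= running_max g n x.
Proof. by case: n => //= n; rewrite le_max lexx. Qed.

Lemma running_max_nondecreasing g n x :
  running_max g n x <= running_max g n.+1 x.
Proof.
elim: n x => [x|n IH x]; first exact: running_max_ge0.
rewrite /= ge_max le_max lexx/= le_max lerD2l.
by rewrite -[_ <= Num.max _ _]/(_ <= running_max g n.+1 (S x)) IH orbT.
Qed.

Lemma ergodic_sum_le_running_max g n x : ergodic_sum g n x <= running_max g n x.
Proof.
elim: n x => [x|n IH x]; first by rewrite /ergodic_sum big_ord0.
by rewrite ergodic_sumS /= le_max lerD2l IH orbT.
Qed.

Lemma bounded_measurable_running_max g n :
  bounded_measurable g -> bounded_measurable (running_max g n).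
Proof.
move=> bg; elim: n => [|n IH]; first exact: bounded_measurable_cst.
apply: bounded_measurable_max0; apply: bounded_measurableD => //.
exact: bounded_measurable_comp.
Qed.

(** Garsia's inequality.  Where the running maximum is positive, the recursion
    reads [running_max g n.+1 x = g x + running_max g n (S x)]; elsewhere the left
    hand side is nonpositive. *)
Lemma running_max_le g n x :
  running_max g n.+1 x - running_max g n.+1 (S x) <=
  g x * \1_[set y | 0 < running_max g n.+1 y] x.
Proof.
rewrite indicE; have [|] := ltP 0 (running_max g n.+1 x) => h.
  rewrite mem_set// mulr1.
  have := running_max_nondecreasing g n (S x).
  move: h; rewrite [running_max _ _ x]/= lt_max ltxx/= => h.
  by rewrite (max_idPr (ltW h)); lra.
rewrite memNset/=; last by apply/negP; rewrite -leNgt.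
have := running_max_ge0 g n.+1 (S x); move: h => /=; lra.
Qed.

(** Garsia's inequality has nonnegative integral on the right because its left
    hand side integrates to 0 over an invariant set; the sets where the running
    maxima are positive then increase to [B]. *)
Lemma maximal_ergodic g B : bounded_measurable g -> measurable B ->
  (forall x, B (S x) <-> B x) ->
  (forall x, B x -> exists n, 0 < ergodic_sum g n x) ->
  0 <= \int[P]_x (g x * \1_B x).
Proof.
move=> bg mB invB Bpos.
pose E n := [set y | 0 < running_max g n y].
have bM n := bounded_measurable_running_max n bg.
have mE n : measurable (E n).
  rewrite /E -[X in measurable X]setTI.
  have -> : [set y | 0 < running_max g n y] = running_max g n @^-1` `]0, +oo[.
    by apply/seteqP; split=> x; rewrite /= in_itv/= andbT.
  by apply: (bM n).1.
have bB := bounded_measurable_indic (R := R) mB.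
have bE n := bounded_measurable_indic (R := R) (mE n).
have S1 x : \1_B (S x) = \1_B x :> R.
  rewrite !indicE; congr (nat_of_bool _)%:R.
  by apply/idP/idP; rewrite !inE; [apply (invB x).1|apply (invB x).2].
have step n : 0 <= \int[P]_x (g x * \1_(E n.+1) x * \1_B x).
  apply: (@le_trans _ _ (\int[P]_x (running_max g n.+1 x * \1_B x -
    running_max g n.+1 (S x) * \1_B (S x)))).
    rewrite RintegralB//; last 2 first.
    - by apply: bounded_measurable_integrable; apply: bounded_measurableM.
    - apply: bounded_measurable_integrable.
      apply: (bounded_measurable_comp (h := fun y => running_max g n.+1 y * \1_B y)) => //.
      exact: bounded_measurableM.
    rewrite (Rintegral_invariant (h := fun y => running_max g n.+1 y * \1_B y)) ?subrr//.
    exact: bounded_measurableM.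
  apply: le_Rintegral => //.
  - apply: bounded_measurable_integrable; apply: bounded_measurableB.
      exact: bounded_measurableM.
    apply: (bounded_measurable_comp (h := fun y => running_max g n.+1 y * \1_B y)) => //.
    exact: bounded_measurableM.
  - apply: bounded_measurable_integrable; apply: bounded_measurableM => //.
    exact: bounded_measurableM.
  - move=> x _; rewrite S1 -mulrBl ler_wpM2r//; exact: running_max_le.
have [C gC] := bg.2.
have [C0|C0] := ltP C 0.
  by apply: Rintegral_ge0 => x _; have := gC x; have := normr_ge0 (g x); lra.
have main n : - (C * fine (P (B `\` E n.+1))) <= \int[P]_x (g x * \1_B x).
  have -> : fine (P (B `\` E n.+1)) = \int[P]_x \1_(B `\` E n.+1) x.
    by rewrite /Rintegral integral_indic ?setIT//; exact: measurableD.
  have bD : bounded_measurable (\1_(B `\` E n.+1) : T -> R).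
    by apply: bounded_measurable_indic; exact: measurableD.
  have bCD : bounded_measurable (fun x => C * \1_(B `\` E n.+1) x).
    apply: bounded_measurableM => //; exact: bounded_measurable_cst.
  rewrite -RintegralZl//; last exact: bounded_measurable_integrable.
  rewrite -subr_ge0 opprK -RintegralD//; last 2 first.
  - by apply: bounded_measurable_integrable; exact: bounded_measurableM.
  - exact: bounded_measurable_integrable.
  apply: le_trans (step n) _; apply: le_Rintegral => //.
  - apply: bounded_measurable_integrable; apply: bounded_measurableM => //.
    exact: bounded_measurableM.
  - apply: bounded_measurable_integrable; apply: bounded_measurableD => //.
    exact: bounded_measurableM.
  - move=> x _; have := gC x; rewrite ler_norml => /andP[g1 g2].
    rewrite !indicE in_setD; case: (x \in B) => /=; case: (x \in E n.+1) => /=; lra.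
have lim0 : P (B `\` E n.+1) @[n --> \oo] --> 0%E.
  have -> : 0%E = P (\bigcap_n (B `\` E n.+1)).
    rewrite (_ : \bigcap_n _ = set0) ?measure0//.
    apply/seteqP; split=> // x /= h.
    have [Bx _] := h 0%N I.
    have [[|n]] := Bpos x Bx; first by rewrite /ergodic_sum big_ord0 ltxx.
    move=> hn; have [_] := h n I; apply; apply: lt_le_trans hn _.
    exact: ergodic_sum_le_running_max.
  apply: nonincreasing_cvg_mu.
  - by apply: le_lt_trans (probability_le1 _ _) (ltry _); exact: measurableD.
  - by move=> n; exact: measurableD.
  - by apply: bigcap_measurable => // n _; exact: measurableD.
  - apply/nonincreasing_seqP => n; apply/subsetPset => x [Bx Ex]; split=> //.
    move=> h; apply: Ex; apply: lt_le_trans h _; exact: running_max_nondecreasing.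
have lim1 : - (C * fine (P (B `\` E n.+1))) @[n --> \oo] --> - (C * 0).
  apply: cvgN; apply: cvgM; first exact: cvg_cst.
  exact: fine_cvg.
rewrite mulr0 oppr0 in lim1.
by apply: (cvgr_to_le lim1); exact: nearW.
Qed.

(** Unlike a strict inequality on the upper limit of the averages, unboundedness
    of the sums is exactly invariant under [S]. *)
Definition unbounded_sums g :=
  [set x | forall K : nat, exists n, K%:R < ergodic_sum g n x].

Lemma measurable_unbounded_sums g : measurable_fun setT g ->
  measurable (unbounded_sums g).
Proof.
move=> mg.
have -> : unbounded_sums g =
    \bigcap_(K : nat) \bigcup_n (ergodic_sum g n @^-1` `]K%:R, +oo[).
  apply/seteqP; split=> x /=.
    by move=> h K _; have [n hn] := h K; exists n => //=; rewrite in_itv/= andbT.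
  by move=> h K; have [n _ /=] := h K I; rewrite in_itv/= andbT; exists n.
apply: bigcap_measurable => // K _; apply: bigcup_measurable => n _.
by rewrite -[X in measurable X]setTI; apply: measurable_ergodic_sum.
Qed.

Lemma unbounded_sums_invariant g : bounded_measurable g -> forall x,
  unbounded_sums g (S x) <-> unbounded_sums g x.
Proof.
move=> [mg [C gC]] x.
have big (K : nat) : exists K' : nat, K%:R + C <= K'%:R.
  by exists (Num.trunc (K%:R + C)).+1; apply/ltW/truncnS_gt.
split=> h K; have [K' KK'] := big K; have [n hn] := h K'.
- exists n.+1; rewrite ergodic_sumS; have := gC x.
  by rewrite ler_norml => /andP[+ _]; lra.
- case: n hn => [|n]; first by rewrite /ergodic_sum big_ord0 ltrn0.
  rewrite ergodic_sumS => hn; exists n; have := gC x.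
  by rewrite ler_norml => /andP[_]; lra.
Qed.

Lemma unbounded_sums_pos g x : unbounded_sums g x ->
  exists n, 0 < ergodic_sum g n x.
Proof. by move=> /(_ 0%N). Qed.

(** If the averages exceed some [r > b] infinitely often and stay below some
    [s < a] infinitely often, both sums are unbounded.  On this invariant set the
    maximal inequality gives both [f >= b] and [f <= a] in the mean, which for
    [a < b] is possible on a null set only. *)
Lemma oscillation_null f a b : bounded_measurable f -> a < b ->
  P (unbounded_sums (fun x => f x - b) `&` unbounded_sums (fun x => a - f x))
    = 0%E.
Proof.
move=> bf ab; set B := _ `&` _.
have bfb : bounded_measurable (fun x => f x - b).
  by apply: bounded_measurableB => //; exact: bounded_measurable_cst.
have baf : bounded_measurable (fun x => a - f x).
  by apply: bounded_measurableB => //; exact: bounded_measurable_cst.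
have mB : measurable B.
  by apply: measurableI; apply: measurable_unbounded_sums;
    [case: bfb|case: baf].
have invB x : B (S x) <-> B x.
  by rewrite /B/=; split=> -[? ?]; split; apply/unbounded_sums_invariant.
have h1 : 0 <= \int[P]_x ((f x - b) * \1_B x).
  by apply: maximal_ergodic => // x [/unbounded_sums_pos].
have h2 : 0 <= \int[P]_x ((a - f x) * \1_B x).
  by apply: maximal_ergodic => // x [_ /unbounded_sums_pos].
have b1 := bounded_measurable_indic (R := R) mB.
have := addr_ge0 h1 h2; rewrite -RintegralD//; last 2 first.
- by apply: bounded_measurable_integrable; exact: bounded_measurableM.
- by apply: bounded_measurable_integrable; exact: bounded_measurableM.
under eq_Rintegral.
  move=> x _; rewrite -mulrDl (_ : f x - b + (a - f x) = a - b); last by ring.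
  over.
rewrite RintegralZl//; last exact: bounded_measurable_integrable.
rewrite /Rintegral integral_indic// setIT nmulr_rge0 ?subr_lt0// => le0.
have fP : P B \is a fin_num by apply: fin_num_measure.
by apply/eqP; rewrite eq_le measure_ge0 andbT -(fineK fP) lee_fin.
Qed.

(** The limit is the supremum of the levels that are exceeded infinitely
    often. *)
Lemma cvg_of_no_oscillation (A : nat -> R) C : (forall n, `|A n| <= C) ->
  (forall a b : rat, (ratr a : R) < ratr b ->
    ~ ((exists2 r, ratr b < r & forall N, exists2 n, (N <= n)%N & r < A n) /\
       (exists2 r, r < ratr a & forall N, exists2 n, (N <= n)%N & A n < r))) ->
  cvg (A n @[n --> \oo]).
Proof.
move=> AC noosc.
have AC' n : - C <= A n <= C by rewrite -ler_norml.
pose Z := [set r | forall N, exists2 n, (N <= n)%N & r < A n].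
have Z0 : Z (- C - 1).
  by move=> N; exists N => //; have /andP[+ _] := AC' N; lra.
have supZ : has_sup Z.
  split; first by exists (- C - 1).
  exists C => r /(_ 0%N)[n _ rn]; have /andP[_] := AC' n; lra.
pose L := sup Z.
apply/cvg_ex; exists L; apply/cvgrPdist_le => e e0.
have e20 : 0 < e / 2 by lra.
have up : \forall n \near \oo, A n <= L + e / 2.
  have : ~ Z (L + e / 2).
    by move=> /(ub_le_sup supZ.2); rewrite -/L; lra.
  move/existsNP => [N hN]; exists N => // n /= Nn; rewrite leNgt.
  by apply/negP => hn; apply: hN; exists n.
have down : \forall n \near \oo, L - e <= A n.
  apply: contrapT => h.
  have [r Zr rL] := sup_adherent e20 supZ.
  rewrite -/L in rL.
  have lr : L - e < r by lra.
  have [a] := rat_in_itvoo lr; rewrite in_itv/= => /andP[a1 a2].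
  have [b] := rat_in_itvoo a2; rewrite in_itv/= => /andP[b1 b2].
  apply: (noosc a b b1); split; first by exists r.
  exists (L - e) => // N; apply: contrapT => hN; apply: h.
  exists N => // n /= Nn; rewrite leNgt; apply/negP => An.
  by apply: hN; exists n.
near=> n; rewrite ler_norml; apply/andP.
have h1 : A n <= L + e / 2 by near: n.
have h2 : L - e <= A n by near: n.
by split; lra.
Unshelve. all: by end_near. Qed.

Theorem birkhoff f : bounded_measurable f ->
  {ae P, forall x, cvg (n%:R^-1 * ergodic_sum f n x @[n --> \oo])}.
Proof.
move=> bf.
pose B (a b : R) :=
  unbounded_sums (fun x => f x - b) `&` unbounded_sums (fun x => a - f x).
pose ab n : rat * rat := odflt (0, 0) (unpickle n).
have key : {ae P, forall x, forall n, (ratr (ab n).1 : R) < ratr (ab n).2 ->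
    ~ B (ratr (ab n).1) (ratr (ab n).2) x}.
  apply: ae_foralln => n; have [lt|ge] := ltP (ratr (ab n).1 : R) (ratr (ab n).2).
    exists (B (ratr (ab n).1) (ratr (ab n).2)); split.
    - apply: measurableI; apply: measurable_unbounded_sums;
        by apply: measurable_funB => //; case: bf.
    - exact: oscillation_null.
    - by move=> x /= h; apply: contrapT => nB; apply: h => _.
  by apply: aeW => x.
apply: filterS key => x hx.
have [C fC] := bf.2.
have C0 : 0 <= C := le_trans (normr_ge0 _) (fC x).
have avgC n : `|n%:R^-1 * ergodic_sum f n x| <= C.
  have sumC : `|ergodic_sum f n x| <= n%:R * C.
    apply: (le_trans (ler_norm_sum _ _ _)).
    apply: (@le_trans _ _ (\sum_(i < n) C)); first exact: ler_sum.
    by rewrite sumr_const card_ord mulr_natl.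
  case: n sumC => [|n] sumC; first by rewrite invr0 mul0r normr0.
  by rewrite normrM gtr0_norm ?invr_gt0// ler_pdivrMl.
apply: (cvg_of_no_oscillation avgC) => a b altb.
move=> [[r br hr] [s sa hs]].
have := hx (pickle (a, b)); rewrite /ab pickleK/= => /(_ altb); apply.
have sumB c n : ergodic_sum (fun y => f y - c) n x = ergodic_sum f n x - n%:R * c.
  by rewrite /ergodic_sum big_split/= sumrN sumr_const card_ord mulr_natl.
have sumB' c n : ergodic_sum (fun y => c - f y) n x = n%:R * c - ergodic_sum f n x.
  by rewrite /ergodic_sum big_split/= sumrN sumr_const card_ord mulr_natl.
split => K.
- have [n] := hr (Num.trunc (K%:R / (r - ratr b))).+1.
  case: n => // n Nn rn; exists n.+1; rewrite sumB.
  rewrite ltr_pdivlMl// in rn.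
  have : K%:R / (r - ratr b) < n.+1%:R.
    by apply: lt_le_trans (truncnS_gt _) _; rewrite ler_nat.
  rewrite ltr_pdivrMr ?subr_gt0// => KK; apply: lt_trans KK _.
  by rewrite mulrBr ltrD2r.
- have [n] := hs (Num.trunc (K%:R / (ratr a - s))).+1.
  case: n => // n Nn rn; exists n.+1; rewrite sumB'.
  rewrite ltr_pdivrMl// in rn.
  have : K%:R / (ratr a - s) < n.+1%:R.
    by apply: lt_le_trans (truncnS_gt _) _; rewrite ler_nat.
  rewrite ltr_pdivrMr ?subr_gt0// => KK; apply: lt_trans KK _.
  by rewrite mulrBr ltrD2l ltrN2.
Qed.

End Birkhoff.

(** * Inner regularity of tight measures *)

Section InnerRegularity.
Context {R : realType} {T : ptopologicalType}.
Local Notation BT := (g_sigma_algebraType (@open T)).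
Variable P : probability BT R.
Variable g : nat -> T -> R.
Hypothesis cg : forall i, continuous (g i).
Hypothesis g_sep : forall x y, (forall i, g i x = g i y) -> x = y.
Hypothesis tight : forall e : R, 0 < e ->
  exists2 K : set T, compact K & (P (~` K : set BT) < e%:E)%E.

Lemma separated_hausdorff : hausdorff_space T.
Proof.
move=> x y xy; apply: g_sep => i; apply: (@Rhausdorff R).
move=> A B /cg xA /cg yB.
by have [z [Az Bz]] := xy _ _ xA yB; exists (g i z).
Qed.

Lemma open_measurable (A : set T) : open A -> measurable (A : set BT).
Proof. by move=> oA; apply: sub_sigma_algebra. Qed.

Lemma closed_measurable (A : set T) : closed A -> measurable (A : set BT).
Proof.
move=> cA; rewrite -(setCK A); apply: measurableC; apply: open_measurable.
exact: closed_openC.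
Qed.

Let sep_dist n x y := \sum_(i < n) `|g i x - g i y|.

Let sep_dist_continuous n y : continuous (fun x => sep_dist n x y).
Proof.
move=> x; rewrite /sep_dist; apply: cvg_big => [|i _]; first exact: add_continuous.
by apply: cvg_norm; apply: cvgB; [exact: cg|exact: cvg_cst].
Qed.

Let sep_dist_continuousr n x : continuous (fun y => sep_dist n x y).
Proof.
move=> y; rewrite /sep_dist; apply: cvg_big => [|i _]; first exact: add_continuous.
by apply: cvg_norm; apply: cvgB; [exact: cvg_cst|exact: cg].
Qed.

Let sep_dist_homo m n x y : (m <= n)%N -> sep_dist m x y <= sep_dist n x y.
Proof.
move=> mn; rewrite /sep_dist.
rewrite (big_ord_widen n (fun i => `|g i x - g i y|))//.
by rewrite [leRHS](bigID (fun i : 'I_n => (i < m)%N))/= lerDl sumr_ge0.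
Qed.

(** The functions [sep_dist n u] increase with [n] and are eventually positive at
    each point of [C], so compactness makes one [n] suffice. *)
Lemma compact_separation (C : set T) u : compact C -> ~ C u ->
  exists n, forall w, C w -> n.+1%:R^-1 < sep_dist n u w.
Proof.
move=> cC Cu; rewrite compact_cover in cC.
pose f n := [set w | n.+1%:R^-1 < sep_dist n u w].
have f_homo m n : (m <= n)%N -> f m `<=` f n.
  move=> mn w /=; rewrite /f/= => h; apply: le_lt_trans (lt_le_trans h _); last first.
    exact: sep_dist_homo.
  by rewrite lef_pV2 ?posrE// ler_nat.
have [||D _ CD] := cC nat setT f.
- move=> n _; rewrite (_ : f n = (fun w => sep_dist n u w) @^-1` `]n.+1%:R^-1, +oo[).
    by apply: open_comp => [x _|]; [exact: sep_dist_continuousr|exact: interval_open].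
  by apply/seteqP; split=> x; rewrite /f/= in_itv/= andbT.
- move=> w Cw.
  have [i giw] : exists i, g i u != g i w.
    apply: contrapT => h; apply: Cu; rewrite (_ : u = w)//.
    apply: g_sep => i; apply/eqP; apply: contrapT => /negP hi.
    by apply: h; exists i.
  have d0 : 0 < `|g i u - g i w| by rewrite normr_gt0 subr_eq0.
  pose k := Num.trunc (`|g i u - g i w|)^-1.
  exists (maxn k i.+1) => //; rewrite /f/=.
  apply: (@lt_le_trans _ _ `|g i u - g i w|).
    rewrite -[ltRHS]invrK ltf_pV2 ?posrE ?invr_gt0//.
    by apply: lt_le_trans (truncnS_gt _) _; rewrite ler_nat ltnS leq_maxl.
  apply: le_trans (sep_dist_homo _ _ (leq_maxr _ _)).
  by rewrite /sep_dist big_ord_recr/= lerDr sumr_ge0.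
exists (\max_(i <- finmap.enum_fset D) i)%N => w /CD[n /= nD fnw].
by apply: f_homo fnw; exact: leq_bigmax_seq.
Qed.

(** On a compact set [K] of almost full measure the separating functions define
    the topology, so the open set is on [K] the union of the closed sets of points
    at a [sep_dist] bounded below from [K \ O]. *)
Lemma open_inner_closed (O : set T) (e : R) : open O -> 0 < e ->
  exists F, [/\ closed F, F `<=` O & (P (O `\` F : set BT) < e%:E)%E].
Proof.
move=> oO e0; have e20 : 0 < e / 2 by lra.
have [K cK PK] := tight e20.
have clK : closed K by apply: compact_closed => //; exact: separated_hausdorff.
have cKO : compact (K `&` ~` O).
  by apply: compact_closedI => //; exact: open_closedC.
pose F n := K `&` \bigcap_(w in K `&` ~` O) [set u | n.+1%:R^-1 <= sep_dist n u w].
have clF n : closed (F n).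
  apply: closedI => //; apply: closed_bigI => w _.
  rewrite (_ : [set u | _] = (fun u => sep_dist n u w) @^-1` `[n.+1%:R^-1, +oo[).
    apply: closed_comp => [x _|]; first exact: sep_dist_continuous.
    exact: interval_closed.
  by apply/seteqP; split=> x; rewrite /= in_itv/= andbT.
have FO n : F n `<=` O.
  move=> u [Ku Fu]; apply: contrapT => Ou.
  have := Fu u (conj Ku Ou) => /=.
  by rewrite /sep_dist big1 ?leNgt ?invr_gt0 ?ltr0Sn// => i _; rewrite subrr normr0.
have mA n : measurable ((O `&` K) `\` F n : set BT).
  apply: measurableD; last exact: closed_measurable.
  by apply: measurableI; [exact: open_measurable|exact: closed_measurable].
have [n hn] : exists n, (P ((O `&` K) `\` F n : set BT) < (e / 2)%:E)%E.
  apply: decreasing_probability_small => //.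
    move=> n u [OKu nF]; split=> // -[_ Fu]; apply: nF; split; first exact: OKu.2.
    move=> w /Fu /= h; apply: le_trans (le_trans h _).
      by rewrite lef_pV2 ?posrE// ler_nat.
    exact: sep_dist_homo.
  rewrite (_ : \bigcap_n _ = set0) ?measure0//.
  apply/seteqP; split=> // u uF.
  have [[Ou Ku] _] := uF 0%N I.
  have [|n hn] := @compact_separation _ u cKO; first by case.
  by have [_] := uF n I; apply; split=> // w /hn /ltW.
exists (F n); split=> //.
rewrite (_ : e = e / 2 + e / 2); last by lra.
apply: (@le_lt_trans _ _ (P ((O `&` K) `\` F n `|` ~` K : set BT))).
  apply: le_measure; rewrite ?inE.
  - by apply: measurableD; [exact: open_measurable|exact: closed_measurable].
  - by apply: measurableU => //; apply: measurableC; exact: closed_measurable.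
  - by move=> u [Ou nF]; have [Ku|] := pselect (K u); [left|right].
apply: le_lt_trans (measureU2 _ _ _) _ => //.
  by apply: measurableC; exact: closed_measurable.
by rewrite EFinD lteD.
Qed.

Let approximable : set (set T) := [set A | measurable (A : set BT) /\
  forall e : R, 0 < e -> exists F G : set T, [/\ closed F, closed G,
    F `<=` A, G `<=` ~` A & (P (~` (F `|` G) : set BT) < e%:E)%E]].

Let approximable_sigma : sigma_algebra setT approximable.
Proof.
split.
- split=> // e e0; exists set0, setT; split=> //.
  - exact: closed0.
  - by rewrite setC0.
  - by rewrite set0U setCT measure0 lte_fin.
- move=> A [mA apA]; split; first exact: measurableD.
  move=> e /apA[F [G [cF cG FA GA PFG]]]; exists G, F; split=> //.
  + by rewrite setTD.
  + by rewrite setTD setCK.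
  + by rewrite setUC.
- move=> A apA; split; first by apply: bigcup_measurable => n _; case: (apA n).
  move=> e e0; have e20 : 0 < e / 2 by lra.
  have ex n : exists FG : set T * set T, [/\ closed FG.1, closed FG.2,
      FG.1 `<=` A n, FG.2 `<=` ~` A n &
      (P (~` (FG.1 `|` FG.2) : set BT) < (e / 2 / (2 ^ n.+1)%:R)%:E)%E].
    have en : 0 < e / 2 / (2 ^ n.+1)%:R by rewrite divr_gt0// ltr0n expn_gt0.
    by have [F [G ?]] := (apA n).2 _ en; exists (F, G).
  have {ex} /choice[FG hFG] := ex.
  pose F n := (FG n).1; pose G := \bigcap_n (FG n).2.
  have cF n : closed (F n) by case: (hFG n).
  have cG : closed G by apply: closed_bigI => n _; case: (hFG n).
  pose U N := \big[setU/set0]_(n < N) F n.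
  have UE N : U N = [set x | exists2 n, (n < N)%N & F n x].
    by rewrite /U -bigcup_mkord.
  have clU N : closed (U N) by apply: closed_bigsetU.
  have mF n : measurable (F n : set BT) by exact: closed_measurable.
  have [N hN] : exists N, (P (\bigcup_n F n `\` U N : set BT) < (e / 2)%:E)%E.
    apply: decreasing_probability_small => //.
    - move=> N; apply: measurableD; last exact: closed_measurable.
      exact: bigcup_measurable.
    - move=> N x [Fx nU]; split=> //; apply: contra_not nU.
      by rewrite !UE => -[n nN Fnx]; exists n => //; exact: leqW.
    - rewrite (_ : \bigcap_n _ = set0) ?measure0//.
      apply/seteqP; split=> // x xF; have [[n _ Fnx] _] := xF 0%N I.
      by have [_] := xF n.+1 I; apply; rewrite UE; exists n.
  exists (U N), G; split=> //.
  + rewrite UE => x [n _ Fnx]; exists n => //.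
    by have [_ _ + _ _] := hFG n; exact.
  + move=> x Gx [n _ Anx].
    by have [_ _ _ + _] := hFG n => /(_ x (Gx n I)); exact.
  have mFG n : measurable (~` ((FG n).1 `|` (FG n).2) : set BT).
    apply: measurableC; apply: closed_measurable; apply: closedU.
      by case: (hFG n).
    by case: (hFG n).
  apply: (@le_lt_trans _ _ (P (\bigcup_n ~` ((FG n).1 `|` (FG n).2) `|`
       (\bigcup_n F n `\` U N) : set BT))).
    apply: le_measure; rewrite ?inE.
    - apply: measurableC; apply: closed_measurable; exact: closedU.
    - apply: measurableU; first exact: bigcup_measurable.
      apply: measurableD; last exact: closed_measurable.
      exact: bigcup_measurable.
    - move=> x nUG; have nU : ~ U N x by move=> h; apply: nUG; left.
      have : ~ G x by move=> h; apply: nUG; right.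
      move/existsNP => [n /not_implyP [_ nGn]].
      have [Fnx|nFnx] := pselect (F n x).
        by right; split=> //; exists n.
      by left; exists n => // -[].
  apply: le_lt_trans (measureU2 _ _ _) _.
  - exact: bigcup_measurable.
  - apply: measurableD; last exact: closed_measurable.
    exact: bigcup_measurable.
  rewrite (_ : e = e / 2 + e / 2); last by lra.
  rewrite EFinD lee_ltD//.
    by rewrite fin_num_measure//; exact: bigcup_measurable.
  apply: le_trans (measure_sigma_subadditive _ _ _ (@subset_refl _ _)) _ => //.
    exact: bigcup_measurable.
  apply: le_trans (epsilon_trick0 predT (ltW e20)).
  by apply: lee_nneseries => // n _; apply/ltW; case: (hFG n).
Qed.

(** The sets that are approximable, together with their complements, by closed
    subsets form a sigma-algebra containing the open sets; intersecting with a
    compact set of almost full measure turns closed into compact. *)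
Theorem borel_inner_compact (A : set BT) (e : R) : measurable A -> 0 < e ->
  exists C : set T, [/\ compact C, C `<=` A & (P (A `\` C : set BT) < e%:E)%E].
Proof.
move=> mA e0; have e20 : 0 < e / 2 by lra.
have : approximable A.
  move: A mA; apply: smallest_sub; first exact: approximable_sigma.
  move=> O oO; split; first exact: open_measurable.
  move=> r r0; have [F [cF FO PF]] := open_inner_closed oO r0.
  exists F, (~` O); split=> //; first exact: open_closedC.
  by rewrite setCU setCK setIC.
move=> [_ /(_ _ e20)[F [G [cF cG FA GA PFG]]]].
have [K cK PK] := tight e20.
have clK : closed K by apply: compact_closed => //; exact: separated_hausdorff.
exists (K `&` F); split.
- exact: compact_closedI.
- by move=> x [_ /FA].
have mFG : measurable (~` (F `|` G) : set BT).
  by apply: measurableC; apply: closed_measurable; exact: closedU.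
have mK : measurable (~` K : set BT).
  by apply: measurableC; exact: closed_measurable.
apply: (@le_lt_trans _ _ (P (~` (F `|` G) `|` ~` K : set BT))).
  apply: le_measure; rewrite ?inE.
  - apply: measurableD => //; apply: closed_measurable; exact: closedI.
  - exact: measurableU.
  - move=> x [Ax nKF]; have [Kx|] := pselect (K x); last by right.
    by left=> -[Fx|/GA //]; apply: nKF.
apply: le_lt_trans (measureU2 _ _ _) _ => //.
by rewrite (_ : e = e / 2 + e / 2) ?EFinD ?lteD//; lra.
Qed.

End InnerRegularity.

(** * Riesz representation and weak compactness of balls *)

(** A closed bounded interval is compact, and an ultrafilter converges to each
    of its cluster points. *)
Lemma ultra_bounded_cvg {R : realType} {X : Type} (F : set_system X)
    (g : X -> R) (K : R) :
  UltraFilter F -> F [set x | `|g x| <= K] ->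
  exists l : R, g x @[x --> F] --> l.
Proof.
move=> UF FK; have : compact [set` `[- K, K]] by exact: segment_compact.
have Fim : F (g @^-1` [set` `[- K, K]]).
  by apply: filterS FK => x xK; rewrite /= in_itv/= -ler_norml.
move=> /(_ (g @ F) _ Fim)[l [_ ll]]; exists l => B lB.
have [//|FnB] := in_ultra_setVsetC (g @^-1` B) UF.
have := ll (~` B) B FnB lB; by move=> [y []].
Qed.

Section Hilbert.
Context {R : realType} {V : Type}.
Variables (ip : V -> V -> R) (comb : R -> V -> V -> V).
Hypothesis ipC : forall u v, ip u v = ip v u.
Hypothesis ip_comb : forall a u v w, ip (comb a u v) w = a * ip u w + ip v w.
Hypothesis ip_ge0 : forall u, 0 <= ip u u.

Definition hsqdist u v := ip u u - 2 * ip u v + ip v v.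
Definition hnorm u := Num.sqrt (ip u u).

Lemma ip_combr a u v w : ip w (comb a u v) = a * ip w u + ip w v.
Proof. by rewrite ipC ip_comb ![ip _ w]ipC. Qed.

Lemma hsqdist_ge0 u v : 0 <= hsqdist u v.
Proof.
have := ip_ge0 (comb (-1) u v); rewrite ip_comb !ip_combr [ip v u]ipC.
by rewrite /hsqdist; lra.
Qed.

Lemma cauchy_schwarz_sqr u v : ip u v ^+ 2 <= ip u u * ip v v.
Proof.
have [u0|u0] := eqVneq (ip u u) 0.
  suff -> : ip u v = 0 by rewrite expr0n u0 mul0r.
  apply/eqP; apply/negPn/negP => b0.
  (* The coefficient for which [ip] takes the value -1 if [ip u u = 0]. *)
  have := ip_ge0 (comb (- (ip v v + 1) / (2 * ip u v)) u v).
  rewrite ip_comb !ip_combr u0 [ip v u]ipC; set b := ip u v in b0 *.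
  rewrite mulr0 add0r (_ : _ / _ * b = - (ip v v + 1) / 2); last by field.
  lra.
have up : 0 < ip u u by rewrite lt_neqAle eq_sym u0 ip_ge0.
have := ip_ge0 (comb (- ip u v / ip u u) u v).
rewrite ip_comb !ip_combr [ip v u]ipC => h.
rewrite -subr_ge0 -(pmulr_rge0 _ (_ : 0 < (ip u u)^-1)) ?invr_gt0//.
by apply: le_trans h _; rewrite le_eqVlt; apply/orP; left; apply/eqP; field.
Qed.

Lemma hnorm_ge0 u : 0 <= hnorm u. Proof. exact: sqrtr_ge0. Qed.

Lemma sqr_hnorm u : hnorm u ^+ 2 = ip u u.
Proof. exact: sqr_sqrtr (ip_ge0 u). Qed.

Lemma cauchy_schwarz u v : `|ip u v| <= hnorm u * hnorm v.
Proof.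
rewrite -(@ler_pXn2r _ 2)// ?nnegrE ?mulr_ge0 ?hnorm_ge0//.
by rewrite exprMn !sqr_hnorm real_normK ?num_real// cauchy_schwarz_sqr.
Qed.

Lemma ip_sub_le u u' v :
  `|ip u v - ip u' v| <= Num.sqrt (hsqdist u u') * hnorm v.
Proof.
have -> : ip u v - ip u' v = ip (comb (-1) u' u) v by rewrite ip_comb; ring.
apply: le_trans (cauchy_schwarz _ _) _.
rewrite le_eqVlt; apply/orP; left; apply/eqP; congr (Num.sqrt _ * _).
by rewrite ip_comb !ip_combr /hsqdist [ip u' u]ipC; ring.
Qed.

Lemma hsqdistC u v : hsqdist u v = hsqdist v u.
Proof. by rewrite /hsqdist [ip v u]ipC; ring. Qed.

Lemma hdist_triangle u v w : Num.sqrt (hsqdist u w) <=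
  Num.sqrt (hsqdist u v) + Num.sqrt (hsqdist v w).
Proof.
pose a := comb (-1) v u; pose b := comb (-1) w v.
have -> : hsqdist u v = ip a a.
  by rewrite /a ip_comb !ip_combr /hsqdist [ip v u]ipC; ring.
have -> : hsqdist v w = ip b b.
  by rewrite /b ip_comb !ip_combr /hsqdist [ip w v]ipC; ring.
have -> : hsqdist u w = ip a a + 2 * ip a b + ip b b.
  rewrite /a /b !(ip_comb, ip_combr) /hsqdist.
  by move: (ipC v u) (ipC w u) (ipC w v); lra.
rewrite -(@ler_pXn2r _ 2)// ?nnegrE ?addr_ge0 ?sqrtr_ge0//.
rewrite sqr_sqrtr; last first.
  have := cauchy_schwarz a b; rewrite ler_norml => /andP[+ _].
  have := sqr_ge0 (hnorm a - hnorm b).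
  by rewrite -(sqr_hnorm a) -(sqr_hnorm b) sqrrB; lra.
rewrite sqrrD !sqr_sqrtr// -/(hnorm a) -/(hnorm b).
have := cauchy_schwarz a b; rewrite ler_norml => /andP[_].
lra.
Qed.

Hypothesis ip_complete : forall u : nat -> V,
  (forall e : R, 0 < e -> exists N, forall m n, (N <= m)%N -> (N <= n)%N ->
     hsqdist (u m) (u n) < e) ->
  exists l, hsqdist (u n) l @[n --> \oo] --> (0 : R).

Lemma ip_cvgl (u : nat -> V) l v : hsqdist (u n) l @[n --> \oo] --> (0 : R) ->
  ip (u n) v @[n --> \oo] --> ip l v.
Proof.
move=> ul; apply/cvgrPdist_le => /=.
suff h : Num.sqrt (hsqdist (u n) l) * hnorm v @[n --> \oo] --> (0 : R).
  move=> e e0; near=> n.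
  rewrite distrC; apply: le_trans (ip_sub_le _ _ _) _.
  by near: n; exact: (cvgr_le _ h).
rewrite -(mul0r (hnorm v)); apply: cvgM; last exact: cvg_cst.
rewrite -(sqrtr0 R); apply: continuous_cvg => //; exact: sqrt_continuous.
Unshelve. all: by end_near. Qed.

(** The representing vector minimizes [ip v v - 2 * L v].  The parallelogram
    identity makes minimizing sequences Cauchy, and the minimality along the lines
    through the limit is the equation [L v = ip u v]. *)
Lemma riesz (L : V -> R) (M : R) :
  (forall a u v, L (comb a u v) = a * L u + L v) ->
  (forall v, `|L v| <= M * hnorm v) ->
  inhabited V ->
  exists u, forall v, L v = ip u v.
Proof.
move=> Llin LM [v0].
pose Q v := ip v v - 2 * L v.
have QM v : - M ^+ 2 <= Q v.
  have := LM v; rewrite ler_norml => /andP[_ h].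
  rewrite /Q -sqr_hnorm; have := sqr_ge0 (hnorm v - M).
  by rewrite sqrrB; lra.
have infQ : has_inf (range Q).
  by split; [exists (Q v0), v0|exists (- M ^+ 2) => _ [v _ <-]].
pose I := inf (range Q).
have IQ v : I <= Q v by apply: ge_inf; [exact: infQ.2|exists v].
have /choice[w wI] n : exists v, Q v < I + n.+1%:R^-1.
  have n0 : 0 < n.+1%:R^-1 :> R by rewrite invr_gt0.
  by have [_ [v _ <-] ?] := inf_adherent n0 infQ; exists v.
have para u v : hsqdist u v <= 2 * Q u + 2 * Q v - 4 * I.
  (* The midpoint of [u] and [v], as [comb (- 2^-1) v v] stands for [v / 2]. *)
  have := IQ (comb (2^-1) u (comb (- 2^-1) v v)).
  rewrite /Q !(Llin, ip_comb, ip_combr) [ip v u]ipC /hsqdist.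
  lra.
have [|l wl] := @ip_complete w.
  move=> e e0; pose N := Num.trunc (4 / e).
  exists N => m n Nm Nn; apply: le_lt_trans (para _ _) _.
  have small k : (N <= k)%N -> k.+1%:R^-1 < e / 4.
    move=> Nk; rewrite -[ltRHS]invf_div ltf_pV2 ?posrE ?divr_gt0//.
    by apply: lt_le_trans (truncnS_gt _) _; rewrite ler_nat ltnS.
  have := wI m; have := wI n; have := small _ Nm; have := small _ Nn.
  by move: (n.+1%:R^-1) (m.+1%:R^-1) (Q _) (Q _) => *; lra.
exists l => v.
set c := ip v v; have c0 : 0 <= c := ip_ge0 v.
have key t : 0 <= 2 * t * (ip l v - L v) + t ^+ 2 * c.
  have h : n.+1%:R^-1 + (2 * t * (ip (w n) v - L v) + t ^+ 2 * c) @[n --> \oo] -->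
      0 + (2 * t * (ip l v - L v) + t ^+ 2 * c).
    apply: cvgD; first exact: cvg_harmonic.
    apply: cvgD; last exact: cvg_cst.
    apply: cvgM; first exact: cvg_cst.
    by apply: cvgB; [exact: ip_cvgl|exact: cvg_cst].
  rewrite add0r in h; apply: (cvgr_to_ge h); apply: nearW => n.
  have := IQ (comb t v (w n)); have := wI n.
  rewrite /Q !(Llin, ip_comb, ip_combr) [ip v (w n)]ipC -/c; move: (n.+1%:R^-1) => r *; nra.
pose d := ip l v - L v.
suff : d = 0 by rewrite /d; lra.
have c1 : c + 1 != 0 by rewrite gt_eqF//; lra.
pose q := d / (c + 1).
have dq : d = q * (c + 1) by rewrite /q divfK.
have := key (- q); rewrite -/d dq => h.
have : q ^+ 2 * (c + 2) <= 0 by move: h; clearbody q; lra.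
rewrite pmulr_lle0; last by lra.
move=> q2; have /eqP : q ^+ 2 = 0 by apply/eqP; rewrite eq_le q2 sqr_ge0.
by rewrite sqrf_eq0 => /eqP ->; rewrite mul0r.
Qed.

(** Banach-Alaoglu for ultrafilters: the limits of the coordinates define a
    bounded linear functional, which the Riesz theorem represents by a vector. *)
Theorem weak_ball_ultra_cvg (X : Type) (F : set_system X) (phi : X -> V) (M : R) :
  UltraFilter F -> 0 <= M -> F [set x | hnorm (phi x) <= M] ->
  exists2 u, hnorm u <= M & forall v, ip (phi x) v @[x --> F] --> ip u v.
Proof.
move=> UF M0 FM.
have bnd v : F [set x | `|ip (phi x) v| <= M * hnorm v].
  apply: filterS FM => x /= h; apply: le_trans (cauchy_schwarz _ _) _.
  by rewrite ler_wpM2r// hnorm_ge0.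
have /choice[L LF] v : exists l : R, ip (phi x) v @[x --> F] --> l.
  exact: ultra_bounded_cvg (bnd v).
have Llin a u v : L (comb a u v) = a * L u + L v.
  have h : ip (phi x) (comb a u v) @[x --> F] --> a * L u + L v.
    under eq_fun do rewrite ip_combr.
    by apply: cvgD => //; apply: cvgM => //; exact: cvg_cst.
  exact: (cvg_unique (@Rhausdorff R) (LF _) h).
have LM v : `|L v| <= M * hnorm v.
  apply: (cvgr_to_le (cvg_norm (LF v))); exact: bnd.
have [|u uL] := riesz Llin LM.
  by have [x _] := filter_ex FM; constructor; exact: (phi x).
exists u; last by move=> v; rewrite -uL; exact: LF.
have := LM u; rewrite uL ger0_norm// -sqr_hnorm expr2.
have [->|u0] := eqVneq (hnorm u) 0; first by [].
by rewrite ler_pM2r// lt_neqAle eq_sym u0 hnorm_ge0.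
Qed.

End Hilbert.

(** * Completeness of the space of square-integrable functions *)

Section SquareIntegrable.
Context {d} {T : measurableType d} {R : realType}.
Variable mu : {measure set T -> \bar R}.
Local Notation Lf := (Lfun mu 2%:E).

Lemma Lfun2_measurable (f : T -> R) : f \in Lf -> measurable_fun setT f.
Proof. by rewrite inE => /andP[/[!inE]]. Qed.

Lemma Lfun2P (f : T -> R) : measurable_fun setT f ->
  (\int[mu]_x ((f x) ^+ 2)%:E < +oo)%E -> f \in Lf.
Proof.
move=> mf fin; rewrite inE; apply/andP; split; rewrite inE//=.
rewrite /finite_norm unlock /Lnorm.
apply: poweR_lty; apply: le_lt_trans fin.
rewrite le_eqVlt; apply/orP; left; apply/eqP; apply: eq_integral => x _ /=.
by rewrite powR_mulrn// -normrX ger0_norm// sqr_ge0.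
Qed.

Lemma Lfun2_mul_integrable (f g : T -> R) : f \in Lf -> g \in Lf ->
  mu.-integrable setT (EFin \o (fun x => f x * g x)).
Proof. by move=> lf lg; apply/Lfun1_integrable; exact: Lfun2_mul_Lfun1. Qed.

Lemma ae_eq_Rintegral (f g : T -> R) : measurable_fun setT f ->
  measurable_fun setT g -> (\forall x \ae mu, f x = g x) ->
  \int[mu]_x f x = \int[mu]_x g x.
Proof.
move=> mf mg fg; rewrite /Rintegral; congr fine; apply: ae_eq_integral => //.
- exact/measurable_EFinP.
- exact/measurable_EFinP.
- by apply: filterS fg => x /= -> _.
Qed.

Lemma bounded_Lfun2 (f : T -> R) C : (mu setT < +oo)%E ->
  measurable_fun setT f -> (forall x, `|f x| <= C) -> f \in Lf.
Proof.
move=> muT mf fC; apply: Lfun2P => //.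
have mf2 : measurable_fun setT (fun x => f x ^+ 2) by exact: measurable_funX.
have /integrableP[_] : mu.-integrable setT (EFin \o (fun x => f x ^+ 2)).
  apply: measurable_bounded_integrable => //.
  exists (C ^+ 2); split; first exact: num_real.
  move=> M CM x _; apply: le_trans (ltW CM).
  by rewrite normrX lerXn2r ?nnegrE// (le_trans _ (fC x)).
by under eq_integral do rewrite /= ger0_norm ?sqr_ge0//.
Qed.

End SquareIntegrable.

Section RieszFischer.
Context {d} {T : measurableType d} {R : realType}.
Variable mu : {measure set T -> \bar R}.
Hypothesis mu_fin : (mu setT < +oo)%E.
Local Notation Lf := (Lfun mu 2%:E).

(** The inequality [|a| <= 2^k a^2 + 2^-k] turns a geometric decay in mean square
    into a summable sequence of L^1 norms, the measure being finite; hence the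
    increments are absolutely summable almost everywhere. *)
Lemma ae_cvg_of_rapid_cauchy (g : nat -> T -> R) :
  (forall k, g k \in Lf) ->
  (forall k, (\int[mu]_x ((g k.+1 x - g k x) ^+ 2)%:E <= ((4 ^+ k)^-1)%:E)%E) ->
  exists G, [/\ measurable G, mu (~` G) = 0%E &
    forall x, G x -> cvg (g k x @[k --> \oo])].
Proof.
move=> gL small.
have mg k : measurable_fun setT (g k) by exact: Lfun2_measurable (gL k).
have mdiff k : measurable_fun setT (fun x => g k.+1 x - g k x).
  exact: measurable_funB.
pose a k x : \bar R := (`|g k.+1 x - g k x|)%:E.
have ma k : measurable_fun setT (a k).
  by apply/measurable_EFinP; apply: measurableT_comp.
have a0 k x : (0 <= a k x)%E by rewrite lee_fin.
pose s x := (\sum_(0 <= k <oo) a k x)%E.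
have ms : measurable_fun setT s.
  by apply: ge0_emeasurable_sum.
pose m := fine (mu setT).
have muE : mu setT = m%:E by rewrite /m fineK// ge0_fin_numE.
have m0 : 0 <= m by apply: fine_ge0.
have inta k : (\int[mu]_x a k x <= ((1 + m) * (2 ^+ k)^-1)%:E)%E.
  apply: (@le_trans _ _ (\int[mu]_x ((2 ^+ k)%:E * ((g k.+1 x - g k x) ^+ 2)%:E
      + ((2 ^+ k)^-1)%:E))%E).
    apply: ge0_le_integral => //.
    - apply/measurable_EFinP; apply: measurable_funD => //.
      by apply: measurable_funM => //; exact: measurable_funX.
    - move=> x _; rewrite -EFinM -EFinD lee_fin.
      set b := g k.+1 x - g k x; rewrite -[b ^+ 2]real_normK ?num_real//.
      set c := `|b|; have p0 : 0 < (2 : R) ^+ k by rewrite exprn_gt0.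
      have := sqr_ge0 (2 ^+ k * c - 1); rewrite sqrrB expr1n mulr1 exprMn => h.
      have c0 : 0 <= c by rewrite normr_ge0.
      rewrite -(ler_pM2l p0) mulrDr divff ?gt_eqF//.
      by have := mulr_ge0 (ltW p0) c0; move: h; rewrite expr2; lra.
  rewrite ge0_integralD//; last 2 first.
  - by move=> x _; rewrite -EFinM lee_fin mulr_ge0 ?sqr_ge0 ?exprn_ge0.
  - apply/measurable_EFinP.
    by apply: measurable_funM => //; exact: measurable_funX.
  rewrite ge0_integralZl//; last 2 first.
  - by apply/measurable_EFinP; exact: measurable_funX.
  - by move=> x _; rewrite lee_fin sqr_ge0.
  rewrite integral_cst//= muE mulrDl mul1r EFinD leeD//; last first.
    by rewrite -EFinM mulrC.
  apply: (@le_trans _ _ ((2 ^+ k)%:E * ((4 ^+ k)^-1)%:E)%E).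
    by rewrite lee_pmul2l// lte_fin exprn_gt0.
  rewrite -EFinM lee_fin (_ : 4 = 2 * 2 :> R) ?exprMn; last by rewrite -natrM.
  by rewrite invfM mulrA divff ?mul1r// gt_eqF// exprn_gt0.
have ints : (\int[mu]_x s x < +oo)%E.
  rewrite /s integral_nneseries//.
  apply: (@le_lt_trans _ _ (\sum_(0 <= k <oo) (2 * (1 + m) / (2 ^ k.+1)%:R)%:E)%E).
    apply: lee_nneseries => [k _ _|k _]; first exact: integral_ge0.
    apply: le_trans (inta k) _; rewrite lee_fin natrX exprS invfM.
    by rewrite [leRHS](_ : _ = (1 + m) * (2 ^+ k)^-1)//; field; rewrite ?expf_neq0.
  apply: le_lt_trans (epsilon_trick0 predT _) (ltry _).
  by rewrite mulr_ge0// addr_ge0.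
have s0 x : (0 <= s x)%E by exact: nneseries_ge0.
have is_ : mu.-integrable setT s.
  apply/integrableP; split=> //.
  by under eq_integral do rewrite gee0_abs//.
have [N [mN N0 sN]] := integrable_ae measurableT is_.
exists (~` N); split; [exact: measurableC|by rewrite setCK|].
move=> x nNx.
have sx : s x \is a fin_num by apply: contrapT => h; apply: nNx; apply: sN => /= /(_ I).
have cs : cvgn [normed series (fun k => g k.+1 x - g k x)].
  apply: nondecreasing_is_cvgn.
    apply: nondecreasing_series => k _ _ /=; exact: normr_ge0.
  exists (fine (s x)) => _ [n _ <-].
  rewrite -lee_fin fineK// /series/= -sumEFin.
  exact: nneseries_lim_ge.
have := normed_cvg cs.
have -> : series (fun k => g k.+1 x - g k x) = (fun n => g n x - g 0%N x).
  apply/funext => n; rewrite /series /=.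
  by rewrite (telescope_sumr (fun k => g k x)).
move=> /cvg_ex[l hl]; apply/cvg_ex; exists (l + g 0%N x).
under eq_fun do rewrite -[g _ x](subrK (g 0%N x)).
by apply: cvgD => //; exact: cvg_cst.
Qed.

Lemma Lfun2_linear a (f g : T -> R) : f \in Lf -> g \in Lf ->
  (fun x => a * f x + g x) \in Lf.
Proof.
move=> lf lg; have [_ lin] := @Lfun_submod_closed _ _ _ mu _ (lee1n 2).
exact: lin lg.
Qed.

Lemma Lfun2B (f g : T -> R) : f \in Lf -> g \in Lf ->
  (fun x => f x - g x) \in Lf.
Proof.
move=> lf lg; rewrite (_ : (fun x => _) = fun x => -1 * g x + f x).
  exact: Lfun2_linear.
by apply/funext => x; ring.
Qed.

Lemma EFin_sqr_Rintegral (f : T -> R) : f \in Lf ->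
  (\int[mu]_x ((f x) ^+ 2)%:E)%E = (\int[mu]_x (f x ^+ 2))%:E.
Proof.
move=> lf; rewrite /Rintegral fineK//.
exact: integrable_fin_num (Lfun2_integrable_sqr lf).
Qed.

Lemma limn_einf_le (u : (\bar R)^nat) e :
  (forall n, exists2 k, (n <= k)%N & (u k <= e)%E) -> (limn_einf u <= e)%E.
Proof.
move=> ue; rewrite limn_einf_lim; apply: lime_le; first exact: is_cvg_einfs.
apply: nearW => n; have [k nk uk] := ue n.
by apply: le_trans uk; apply: ereal_inf_lbound; exists k.
Qed.

(** Riesz-Fischer: a subsequence converges almost everywhere, and Fatou's lemma
    compares the limit with the whole sequence. *)
Theorem L2_complete (f : nat -> T -> R) : (forall n, f n \in Lf) ->
  (forall e : R, 0 < e -> exists N, forall m n, (N <= m)%N -> (N <= n)%N ->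
     \int[mu]_x ((f m x - f n x) ^+ 2) < e) ->
  exists2 h, h \in Lf & \int[mu]_x ((f n x - h x) ^+ 2) @[n --> \oo] --> (0 : R).
Proof.
move=> fL cauchy.
have mf n : measurable_fun setT (f n) by exact: Lfun2_measurable (fL n).
have /choice[N hN] k : exists N, forall m n, (N <= m)%N -> (N <= n)%N ->
    \int[mu]_x ((f m x - f n x) ^+ 2) < (4 ^+ k)^-1.
  by apply: cauchy; rewrite invr_gt0 exprn_gt0.
(* Nondecreasing indices that lie beyond [N j] for all [j <= k]. *)
pose M k := (\max_(j < k.+1) N j + k)%N.
have MN j k : (j <= k)%N -> (N j <= M k)%N.
  move=> jk; apply: leq_trans (leq_addr _ _).
  by rewrite -ltnS in jk; exact: (leq_bigmax (Ordinal jk)).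
pose g k := f (M k).
have [||G [mG G0 cG]] := @ae_cvg_of_rapid_cauchy g.
- by move=> k; exact: fL.
- move=> k; rewrite EFin_sqr_Rintegral; last by apply: Lfun2B; exact: fL.
  by rewrite lee_fin ltW//; apply: hN; exact: MN.
(* Cut off outside [G], the subsequence converges everywhere, which makes its
   limit measurable. *)
pose g' k x := g k x * \1_G x.
have cg' x : cvg (g' k x @[k --> \oo]).
  rewrite /g' indicE; have [xG|xG] := boolP (x \in G).
    under eq_fun do rewrite mulr1.
    by apply: cG; exact: set_mem.
  by under eq_fun do rewrite mulr0; exact: is_cvg_cst.
pose h x := limn (g' ^~ x).
have g'h x : g' k x @[k --> \oo] --> h x by exact: cg'.
have mg' k : measurable_fun setT (g' k).
  by apply: measurable_funM; [exact: mf|exact: measurable_indic].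
have mh : measurable_fun setT h.
  by by apply: (measurable_fun_cvg mg') => x _; exact: g'h.
have key e n : 0 < e -> (forall m, (n <= m)%N -> \int[mu]_x ((f n x - f m x) ^+ 2) <= e) ->
    (\int[mu]_x ((f n x - h x) ^+ 2)%:E <= e%:E)%E.
  move=> e0 hn.
  pose u k x : \bar R := ((f n x - g' k x) ^+ 2)%:E.
  have mu_ k : measurable_fun setT (u k).
    apply/measurable_EFinP; apply: measurable_funX.
    exact: measurable_funB.
  have u0 k x : setT x -> (0 <= u k x)%E by move=> _; rewrite lee_fin sqr_ge0.
  rewrite (_ : (\int[mu]_x _)%E = (\int[mu]_x limn_einf (u ^~ x))%E); last first.
    apply: eq_integral => x _.
    have ux : u k x @[k --> \oo] --> ((f n x - h x) ^+ 2)%:E.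
      apply/fine_cvgP; split; first exact: nearW.
      rewrite /comp/= expr2; under eq_fun do rewrite expr2.
      by apply: cvgM; apply: cvgB => //; exact: cvg_cst.
    rewrite is_cvg_limn_einfE; last by apply/cvg_ex; eexists; exact: ux.
    by apply/esym/cvg_lim.
  apply: le_trans (fatou _ _ mu_ u0) _ => //.
  apply: limn_einf_le => k; exists (maxn k n); first exact: leq_maxl.
  rewrite (@ae_eq_integral _ _ _ mu setT
    (fun x => ((f n x - g (maxn k n) x) ^+ 2)%:E))//; last 2 first.
  - apply/measurable_EFinP; apply: measurable_funX.
    by apply: measurable_funB => //; exact: mf.
  - exists (~` G); split=> //; first exact: measurableC.
    move=> x /= hx Gx; apply: hx => _.
    by rewrite /u /g' indicE mem_set// mulr1.
  rewrite EFin_sqr_Rintegral; last by apply: Lfun2B; exact: fL.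
  rewrite lee_fin; apply: hn.
  by rewrite (leq_trans (leq_maxr k n))// leq_addl.
have hL : h \in Lf.
  have [n hn] := cauchy 1 ltr01.
  have h1 : (fun x => f n x - h x) \in Lf.
    apply: Lfun2P; first exact: measurable_funB.
    apply: le_lt_trans (key 1 n ltr01 _) (ltry _).
    by move=> m nm; apply/ltW/hn.
  rewrite (_ : h = fun x => f n x - (f n x - h x)); first exact: Lfun2B.
  by apply/funext => x; ring.
exists h => //; apply/cvgrPdist_le => e e0.
have [n0 hn0] := cauchy e e0; exists n0 => // n /= n0n.
rewrite sub0r normrN ger0_norm; last first.
  by apply: Rintegral_ge0 => x _; rewrite sqr_ge0.
rewrite -lee_fin -EFin_sqr_Rintegral; last exact: Lfun2B.
apply: key => // m nm; apply/ltW/hn0 => //; exact: leq_trans nm.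
Qed.

End RieszFischer.

(** * The space H is a separable Hilbert space *)

Section DomainMeasure.
Variables (R : realType) (D : bounded_smooth_domain R).
Local Notation R3 := (R * R * R)%type.
Local Notation mR3 :=
  (measurableTypeR R * measurableTypeR R * measurableTypeR R)%type.
Local Notation mu := (lebesgue_dom D).

Lemma dom_in_cube : exists N : nat, forall x : R3, (dom D) x ->
  [/\ `|x.1.1| <= N%:R, `|x.1.2| <= N%:R & `|x.2| <= N%:R].
Proof.
have [M [_ hM]] := dom_bounded D.
pose N := (Num.trunc `|M|).+1.
have MN : M < N%:R by apply: le_lt_trans (truncnS_gt _); exact: ler_norm.
exists N => x Dx; have := hM _ MN x Dx.
by rewrite /= /Num.norm/= !ge_max => /andP[/andP[]].
Qed.

Lemma lebesgue_dom_finite : (mu setT < +oo)%E.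
Proof.
have [N hN] := dom_in_cube.
rewrite /lebesgue_dom /= /mrestr setTI.
pose I : set (measurableTypeR R) := [set` `[- N%:R, N%:R]].
have mI : measurable I by exact: measurable_itv.
apply: (@le_lt_trans _ _ (@lebesgue3 R ((I `*` I) `*` I))).
  rewrite /lebesgue3; apply: le_measure; rewrite ?inE.
  - exact: measurable_dom.
  - by apply: measurableX => //; exact: measurableX.
  - by move=> x /hN; rewrite !ler_norml /I /= !in_itv /= => -[].
rewrite /lebesgue3 product_measure1E//; last exact: measurableX.
rewrite [X in (X * _)%E]product_measure1E//.
have /fineK : (lebesgue_measure I : \bar R) \is a fin_num.
  by rewrite ge0_fin_numE// /I lebesgue_measure_itv; case: ifP => _; rewrite ?ltry.
move=> IE.
suff : (lebesgue_measure I * lebesgue_measure I * lebesgue_measure I < +oo :> \bar R)%E by [].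
by rewrite -IE -!EFinM ltry.
Qed.

Lemma continuous_measurable3 (phi : R3 -> R) : continuous phi ->
  measurable_fun setT (phi : mR3 -> R).
Proof.
move=> cphi; apply: (measurability _ (RGenOInfty.measurableE R)).
move=> /= _ [_ [a ->]] <-; rewrite setTI; apply: open_measurable3.
apply: open_comp => [x _|]; [exact: cphi|exact: interval_open].
Qed.

(** A test function is bounded and the domain has finite measure. *)
Lemma test_function_Lfun2 (phi : R3 -> R) : test_function D phi ->
  (phi : mR3 -> R) \in Lfun mu 2%:E.
Proof.
move=> [sphi [K [cK KD phi0]]].
have cphi : continuous phi by exact: (sphi 0%N).
have [M hM] : exists M, forall x, K x -> `|phi x| <= M.
  have : compact (phi @` K).
    by apply: continuous_compact => //; apply: continuous_subspaceT.
  move=> /compact_bounded[M [_ hM]]; exists (M + 1) => x Kx.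
  by apply: (hM (M + 1)); [rewrite ltrDl|exists x].
apply: (@bounded_Lfun2 _ _ _ mu _ `|M|) => //.
- exact: lebesgue_dom_finite.
- exact: continuous_measurable3.
- move=> x; have [Kx|nKx] := pselect (K x).
    by apply: le_trans (hM x Kx) (ler_norm _).
  by rewrite phi0// normr0.
Qed.

Lemma class_C_linear k (a : R) (phi psi : R3 -> R) :
  class_C k phi -> class_C k psi -> class_C k (fun x => a * phi x + psi x).
Proof.
elim: k phi psi => [|k IH] phi psi /=.
  move=> cphi cpsi x; apply: cvgD; last exact: cpsi.
  by apply: cvgM; [exact: cvg_cst|exact: cphi].
move=> [cphi dphi pphi] [cpsi dpsi ppsi]; split.
- move=> x; apply: cvgD; last exact: cpsi.
  by apply: cvgM; [exact: cvg_cst|exact: cphi].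
- by move=> j x; apply: derivableD => //; apply: derivableZ.
- move=> j; rewrite (_ : partial j _ = fun x => a * partial j phi x + partial j psi x).
    exact: IH.
  apply/funext => x; rewrite /partial.
  by rewrite (@deriveD _ _ _ (fun x => a * phi x) psi)//; [rewrite deriveZ|apply: derivableZ].
Qed.

Lemma test_function_linear (a : R) (phi psi : R3 -> R) :
  test_function D phi -> test_function D psi ->
  test_function D (fun x => a * phi x + psi x).
Proof.
move=> [sphi [K [cK KD phi0]]] [spsi [L [cL LD psi0]]]; split.
  by move=> k; exact: class_C_linear.
exists (K `|` L); split.
- exact: compactU.
- by move=> x [/KD|/LD].
- by move=> x /not_orP[/phi0 -> /psi0 ->]; rewrite mulr0 addr0.
Qed.

Lemma solenoidal_test_linear (a : R) (phi psi : 'I_3 -> R3 -> R) :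
  solenoidal_test D phi -> solenoidal_test D psi ->
  solenoidal_test D (fun i x => a * phi i x + psi i x).
Proof.
move=> [tphi dphi] [tpsi dpsi]; split.
  by move=> i; exact: test_function_linear.
move=> x; transitivity (\sum_(i < 3) (a * partial i (phi i) x + partial i (psi i) x)).
  apply: eq_bigr => i _; rewrite /partial.
  have [sphi _] := tphi i; have [spsi _] := tpsi i.
  have [_ dphi' _] := sphi 1%N; have [_ dpsi' _] := spsi 1%N.
  rewrite (@deriveD _ _ _ (fun x => a * phi i x) (psi i))//; last exact: derivableZ.
  by rewrite deriveZ.
by rewrite big_split/= -mulr_sumr dphi dpsi mulr0 addr0.
Qed.

End DomainMeasure.

Section HilbertH.
Variables (R : realType) (D : bounded_smooth_domain R).
Local Notation R3 := (R * R * R)%type.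
Local Notation mR3 :=
  (measurableTypeR R * measurableTypeR R * measurableTypeR R)%type.
Local Notation mu := (lebesgue_dom D).
Local Notation Lf := (Lfun mu 2%:E).

Lemma L2_Lfun (u : L2 D) : (u : mR3 -> R) \in Lf.
Proof.
rewrite inE; apply/andP; split; rewrite inE/=.
  exact: (@measurable_funPT _ _ _ _ (repr (u : {mfun_ mu, mR3 >-> measurableTypeR R}))).
exact: Lebesgue_finite.
Qed.

Lemma L2_of_Lfun (g : mR3 -> R) : g \in Lf ->
  exists h : L2 D, \forall x \ae mu, (h : mR3 -> R) x = g x.
Proof.
move=> lg.
have mg : measurable_fun setT (g : mR3 -> measurableTypeR R) := Lfun2_measurable lg.
pose gm : {mfun mR3 >-> measurableTypeR R} :=
  HB.pack g (isMeasurableFun.Build _ _ mR3 (measurableTypeR R) g mg).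
pose c : {mfun_ mu, mR3 >-> measurableTypeR R} :=
  \pi_({mfun_ mu, mR3 >-> measurableTypeR R})%qT gm.
have cg : \forall x \ae mu, (c : mR3 -> R) x = g x.
  have : ae_eq_op mu (repr c) gm by rewrite -eqmodE; apply/eqP; rewrite reprK.
  by move=> /asboolP; apply: filterS => x /= /(_ I).
have mc : measurable_fun setT (c : mR3 -> R).
  exact: (@measurable_funPT _ _ _ _ (repr c)).
have fc : finite_norm mu 2%:R%:E (c : mR3 -> R).
  have : (c : mR3 -> R) \in Lf.
    apply: Lfun2P => //.
    rewrite (@ae_eq_integral _ _ _ mu setT (fun x => (g x ^+ 2)%:E))//.
    - by rewrite EFin_sqr_Rintegral// ltry.
    - by apply/measurable_EFinP; apply: measurable_funX.
    - by apply/measurable_EFinP; apply: measurable_funX.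
    - by apply: filterS cg => x /= -> _.
  by rewrite inE => /andP[_]; rewrite inE.
pose L : LspaceType mu (lee1n 2) :=
  HB.pack c (isFinLebesgue.Build _ _ _ mu 2%:R%:E (lee1n 2) c fc).
by exists L.
Qed.

Lemma L2_ext (u v : L2 D) :
  (\forall x \ae mu, (u : mR3 -> R) x = (v : mR3 -> R) x) -> u = v.
Proof.
case: u => cu [[pu]]; case: v => cv [[pv]] uv.
have cuv : cu = cv.
  rewrite -[cu]reprK -[cv]reprK; apply/eqP; rewrite eqmodE; apply/asboolP.
  by apply: filterS uv => x /= + _.
move: pu pv {uv}; rewrite cuv => pu pv.
by rewrite (Prop_irrelevance pu pv).
Qed.

(** Fields of square-integrable functions.  Elements of [H] and solenoidal test
    fields both give such fields, which allows one triangle inequality to compare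
    them. *)
Definition Lfield := 'I_3 -> {f : mR3 -> R | f \in Lf}.

Definition Lfield_inner (u v : Lfield) : R :=
  \sum_(i < 3) \int[mu]_x (sval (u i) x * sval (v i) x).

(** The linear combination [a u + v], the only linear operation that the abstract
    Hilbert space arguments use. *)
Definition Lfield_comb (a : R) (u v : Lfield) : Lfield := fun i =>
  exist (fun f => f \in Lf) _ (Lfun2_linear a (svalP (u i)) (svalP (v i))).

Lemma Lfield_innerC u v : Lfield_inner u v = Lfield_inner v u.
Proof.
by apply: eq_bigr => i _; apply: eq_Rintegral => x _; rewrite mulrC.
Qed.

Lemma Lfield_inner_comb a u v w :
  Lfield_inner (Lfield_comb a u v) w = a * Lfield_inner u w + Lfield_inner v w.
Proof.
rewrite /Lfield_inner mulr_sumr -big_split; apply: eq_bigr => i _ /=.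
have iuw := Lfun2_mul_integrable (svalP (u i)) (svalP (w i)).
have ivw := Lfun2_mul_integrable (svalP (v i)) (svalP (w i)).
rewrite -RintegralZl// -RintegralD//.
  by apply: eq_Rintegral => x _; rewrite mulrDl mulrA.
by have := integrableZl measurableT a iuw; apply: eq_integrable.
Qed.

Lemma Lfield_inner_ge0 u : 0 <= Lfield_inner u u.
Proof.
by apply: sumr_ge0 => i _; apply: Rintegral_ge0 => x _; rewrite -expr2 sqr_ge0.
Qed.

Lemma Lfield_hsqdist u v : hsqdist Lfield_inner u v =
  \sum_(i < 3) L2_sqdist D (sval (u i)) (sval (v i)).
Proof.
have -> : hsqdist Lfield_inner u v =
    Lfield_inner (Lfield_comb (-1) v u) (Lfield_comb (-1) v u).
  rewrite Lfield_inner_comb Lfield_innerC [Lfield_inner u _]Lfield_innerC.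
  by rewrite !Lfield_inner_comb /hsqdist [Lfield_inner v u]Lfield_innerC; ring.
by apply: eq_bigr => i _; apply: eq_Rintegral => x _ /=; ring.
Qed.

Definition Lfield_of (u : H D) : Lfield := fun i =>
  exist (fun f : mR3 -> R => f \in Lf) _ (L2_Lfun (H_field u i)).

Definition test_Lfield phi (sphi : solenoidal_test D phi) : Lfield :=
  fun i => exist (fun f : mR3 -> R => f \in Lf) (phi i) (test_function_Lfun2 (sphi.1 i)).

Definition H_inner (u v : H D) : R := L2_inner u v.

Lemma H_innerE u v : H_inner u v = Lfield_inner (Lfield_of u) (Lfield_of v).
Proof. by []. Qed.

Lemma H_innerC u v : H_inner u v = H_inner v u.
Proof. exact: (Lfield_innerC (Lfield_of u) (Lfield_of v)). Qed.

Lemma H_inner_ge0 u : 0 <= H_inner u u.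
Proof. exact: (Lfield_inner_ge0 (Lfield_of u)). Qed.

Lemma L2_distE (u v : H D) : L2_dist u v = Num.sqrt (hsqdist H_inner u v).
Proof.
rewrite /L2_dist.
rewrite -[hsqdist _ _ _]/(hsqdist Lfield_inner (Lfield_of u) (Lfield_of v)).
by rewrite Lfield_hsqdist.
Qed.

Lemma Lfield_dist_comb (a : R) (u v u' v' : Lfield) :
  Num.sqrt (hsqdist Lfield_inner (Lfield_comb a u v) (Lfield_comb a u' v')) <=
  `|a| * Num.sqrt (hsqdist Lfield_inner u u') + Num.sqrt (hsqdist Lfield_inner v v').
Proof.
pose m := Lfield_comb a u' v.
apply: le_trans (hdist_triangle Lfield_innerC Lfield_inner_comb Lfield_inner_ge0 _ m _) _.
have E1 : hsqdist Lfield_inner (Lfield_comb a u v) m = a ^+ 2 * hsqdist Lfield_inner u u'.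
  rewrite /hsqdist /m !(Lfield_inner_comb, ip_combr Lfield_innerC Lfield_inner_comb).
  by rewrite [Lfield_inner v u]Lfield_innerC [Lfield_inner v u']Lfield_innerC; ring.
have E2 : hsqdist Lfield_inner m (Lfield_comb a u' v') = hsqdist Lfield_inner v v'.
  rewrite /hsqdist /m !(Lfield_inner_comb, ip_combr Lfield_innerC Lfield_inner_comb).
  by rewrite [Lfield_inner v u']Lfield_innerC [Lfield_inner v' u']Lfield_innerC; ring.
by rewrite E1 E2 sqrtrM ?sqr_ge0// sqrtr_sqr.
Qed.

(** Replacing the components by their classes modulo null functions changes no
    integral, so a limit of solenoidal test fields is realized in [H]. *)
Lemma H_of_Lfield (w : Lfield) :
  (forall e, 0 < e -> exists phi (sphi : solenoidal_test D phi),
     hsqdist Lfield_inner w (test_Lfield sphi) < e) ->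
  exists h : H D, forall v, Lfield_inner (Lfield_of h) v = Lfield_inner w v.
Proof.
move=> wc; have /choice[h hw] i := L2_of_Lfun (svalP (w i)).
have hmw i : measurable_fun setT (sval (w i)) := Lfun2_measurable (svalP (w i)).
have hmh i : measurable_fun setT (h i : mR3 -> R) := Lfun2_measurable (L2_Lfun (h i)).
have hc e : 0 < e -> exists2 phi, solenoidal_test D phi &
    \sum_(i < 3) L2_sqdist D (h i) (phi i) < e.
  move=> /wc[phi [sphi]]; rewrite Lfield_hsqdist => lt; exists phi => //.
  apply: le_lt_trans lt; rewrite le_eqVlt; apply/orP; left; apply/eqP.
  apply: eq_bigr => i _; apply: ae_eq_Rintegral.
  - apply: measurable_funX; apply: measurable_funB => //.
    exact: Lfun2_measurable (test_function_Lfun2 (sphi.1 i)).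
  - apply: measurable_funX; apply: measurable_funB => //.
    exact: Lfun2_measurable (test_function_Lfun2 (sphi.1 i)).
  - by apply: filterS (hw i) => x /= ->.
exists (MkH hc) => v; apply: eq_bigr => i _; apply: ae_eq_Rintegral.
- by apply: measurable_funM; [exact: hmh|exact: Lfun2_measurable (svalP (v i))].
- by apply: measurable_funM; [exact: hmw|exact: Lfun2_measurable (svalP (v i))].
- by apply: filterS (hw i) => x /= ->.
Qed.

Lemma H_test_approx (u : H D) (e : R) : 0 < e ->
  exists phi (sphi : solenoidal_test D phi),
    Num.sqrt (hsqdist Lfield_inner (Lfield_of u) (test_Lfield sphi)) < e.
Proof.
move=> e0; have [phi sphi lt] := H_closure u (exprn_gt0 2 e0).
exists phi, sphi; rewrite Lfield_hsqdist -(ger0_norm (ltW e0)) -sqrtr_sqr.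
by rewrite ltr_sqrt// exprn_gt0.
Qed.

Lemma H_comb_ex (a : R) (u v : H D) : exists w : H D,
  forall z, H_inner w z = a * H_inner u z + H_inner v z.
Proof.
have [|w hw] := @H_of_Lfield (Lfield_comb a (Lfield_of u) (Lfield_of v)); last first.
  by exists w => z; rewrite H_innerE hw Lfield_inner_comb.
move=> e e0; pose r := Num.sqrt e / (2 * (`|a| + 1)).
have r0 : 0 < r by rewrite divr_gt0 ?sqrtr_gt0// mulr_gt0// ltr_wpDl.
have [phi [sphi lu]] := H_test_approx u r0.
have [psi [spsi lv]] := H_test_approx v r0.
have st := solenoidal_test_linear a sphi spsi.
exists _, st.
have -> : hsqdist Lfield_inner (Lfield_comb a (Lfield_of u) (Lfield_of v))
    (test_Lfield st) =
  hsqdist Lfield_inner (Lfield_comb a (Lfield_of u) (Lfield_of v))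
    (Lfield_comb a (test_Lfield sphi) (test_Lfield spsi)) by [].
rewrite -(@ltr_sqrt _ _ e)//.
apply: le_lt_trans (Lfield_dist_comb _ _ _ _ _) _.
apply: (@lt_le_trans _ _ (`|a| * r + r)).
  by rewrite ler_ltD// ler_wpM2l// ltW.
have -> : `|a| * r + r = Num.sqrt e / 2.
  by rewrite /r; field; rewrite gt_eqF// ltr_wpDl.
by rewrite ler_pdivrMr// ler_peMr// ?sqrtr_ge0// ler1n.
Qed.

(** The type [H] carries no vector space structure: a linear combination is
    chosen among the elements of [H] with the right inner products, which are all
    equal by [H_ext]. *)
Definition H_comb (a : R) (u v : H D) : H D := xget u
  [set w | forall z, H_inner w z = a * H_inner u z + H_inner v z].

Lemma H_inner_comb a u v z :
  H_inner (H_comb a u v) z = a * H_inner u z + H_inner v z.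
Proof.
rewrite /H_comb; case: xgetP => [w _ ->//|nw].
by have [w hw] := H_comb_ex a u v; case: (nw w).
Qed.

Local Notation normH := (hnorm H_inner).
Local Notation distH u v := (Num.sqrt (hsqdist H_inner u v)).

Lemma H_cauchy_schwarz u v : `|H_inner u v| <= normH u * normH v.
Proof. exact: cauchy_schwarz H_innerC H_inner_comb H_inner_ge0 u v. Qed.

Lemma H_inner_sub_le u u' v :
  `|H_inner u v - H_inner u' v| <= distH u u' * normH v.
Proof. exact: ip_sub_le H_innerC H_inner_comb H_inner_ge0 u u' v. Qed.

Lemma H_dist_triangle u v w : distH u w <= distH u v + distH v w.
Proof. exact: hdist_triangle H_innerC H_inner_comb H_inner_ge0 u v w. Qed.

Lemma H_sqdistC u v : hsqdist H_inner u v = hsqdist H_inner v u.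
Proof. exact: hsqdistC H_innerC u v. Qed.

Lemma sqr_H_norm u : normH u ^+ 2 = H_inner u u.
Proof. exact: sqr_hnorm H_inner_ge0 u. Qed.

Lemma H_ext (u v : H D) : (forall z, H_inner u z = H_inner v z) -> u = v.
Proof.
move=> uv.
have sq0 i : \int[mu]_x (((H_field u i : mR3 -> R) x - (H_field v i : mR3 -> R) x) ^+ 2) = 0.
  have : \sum_(i < 3) L2_sqdist D (H_field u i) (H_field v i) = 0.
    transitivity (hsqdist H_inner u v).
      by rewrite -[RHS]/(hsqdist Lfield_inner (Lfield_of u) (Lfield_of v)) Lfield_hsqdist.
    by rewrite /hsqdist uv !(H_innerC v) uv; ring.
  have ge0 j : 0 <= L2_sqdist D (H_field u j) (H_field v j).
    by apply: Rintegral_ge0 => x _; rewrite sqr_ge0.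
  by move=> /eqP; rewrite psumr_eq0// => /allP/(_ i (mem_index_enum _))/eqP.
have fuv : H_field u = H_field v.
  apply/funext => i; apply: L2_ext.
  have lf : (fun x => (H_field u i : mR3 -> R) x - (H_field v i : mR3 -> R) x) \in Lf.
    by apply: Lfun2B; exact: L2_Lfun.
  have mf := Lfun2_measurable lf.
  have h := EFin_sqr_Rintegral lf; rewrite /= sq0 in h.
  have mf2 : measurable_fun setT (fun x : mR3 =>
      (((H_field u i : mR3 -> R) x - (H_field v i : mR3 -> R) x) ^+ 2)%:E).
    by apply/measurable_EFinP; exact: measurable_funX.
  have /(ae_eq_integral_abs mu measurableT mf2) : (\int[mu]_x
      `|(((H_field u i : mR3 -> R) x - (H_field v i : mR3 -> R) x) ^+ 2)%:E| = 0)%E.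
    by under eq_integral do rewrite gee0_abs ?lee_fin ?sqr_ge0//.
  apply: filterS => x /= /(_ I) [] /eqP.
  by rewrite sqrf_eq0 subr_eq0 => /eqP.
case: u v {uv sq0} fuv => [fu pu] [fv pv] /= fuv.
by move: pu; rewrite fuv => pu; rewrite (Prop_irrelevance pu pv).
Qed.

End HilbertH.

(** Heine's theorem, with a modulus of the form [1 / n.+1]. *)
Lemma compact_uniform_continuity {R : realType} {T : pseudoMetricType R}
    (K : set T) (phi : T -> R) (e : R) :
  compact K -> continuous phi -> 0 < e ->
  \forall n \near \oo, forall x, K x -> forall y, ball x n.+1%:R^-1 y ->
    `|phi x - phi y| < e.
Proof.
move=> cK cphi e0.
apply: (compact_near_coveringP K).1 => // x Kx.
have e20 : 0 < e / 2 by lra.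
have /cvgrPdist_lt/(_ _ e20) := cphi x.
move=> /nbhs_ballP[r /= r0 rphi].
have r20 : 0 < r / 2 by lra.
exists (ball x (r / 2), [set n | n.+1%:R^-1 < r / 2]).
  split; first exact: nbhsx_ballx.
  exists (Num.trunc (r / 2)^-1) => // n /= hn.
  rewrite -[ltRHS]invrK ltf_pV2 ?posrE ?invr_gt0//.
  by apply: lt_le_trans (truncnS_gt _) _; rewrite ler_nat ltnS.
move=> [x' n] [/= xx' nr] y x'y.
have h1 : `|phi x - phi x'| < e / 2.
  by apply: rphi; apply: le_ball xx'; lra.
have h2 : `|phi x - phi y| < e / 2.
  apply: rphi; apply: (@le_ball _ _ _ (r / 2 + n.+1%:R^-1)).
    by rewrite [leRHS](splitr r) lerD2l ltW.
  exact: ball_triangle xx' x'y.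
rewrite (splitr e) (_ : phi x' - phi y = (phi x' - phi x) + (phi x - phi y)); last by ring.
by apply: le_lt_trans (ler_normD _ _) _; rewrite ltrD// distrC.
Qed.

Section Complete.
Variables (R : realType) (D : bounded_smooth_domain R).
Local Notation R3 := (R * R * R)%type.
Local Notation mR3 :=
  (measurableTypeR R * measurableTypeR R * measurableTypeR R)%type.
Local Notation mu := (lebesgue_dom D).
Local Notation Lf := (Lfun mu 2%:E).
Local Notation ipL := (@Lfield_inner R D).
Local Notation ipH := (@H_inner R D).

Let distL_triangle := hdist_triangle (@Lfield_innerC R D) (@Lfield_inner_comb R D)
  (@Lfield_inner_ge0 R D).

(** The components converge by Riesz-Fischer, and limits of elements of [H] are
    limits of solenoidal test fields. *)
Lemma H_complete (u : nat -> H D) :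
  (forall e : R, 0 < e -> exists N, forall m n, (N <= m)%N -> (N <= n)%N ->
     hsqdist ipH (u m) (u n) < e) ->
  exists l, hsqdist ipH (u n) l @[n --> \oo] --> (0 : R).
Proof.
move=> cu.
have sqdist_ge0 (f g : R3 -> R) : 0 <= L2_sqdist D f g.
  by apply: Rintegral_ge0 => x _; rewrite sqr_ge0.
have HE m n : hsqdist ipH (u m) (u n) =
    \sum_(i < 3) L2_sqdist D (H_field (u m) i) (H_field (u n) i).
  by rewrite -[LHS]/(hsqdist ipL (Lfield_of (u m)) (Lfield_of (u n))) Lfield_hsqdist.
have lim i : {w : {f : mR3 -> R | f \in Lf} |
    L2_sqdist D (H_field (u n) i) (sval w) @[n --> \oo] --> (0 : R)}.
  apply: cid.
  have [||h hL hc] := @L2_complete _ _ _ mu (lebesgue_dom_finite D)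
    (fun n => (H_field (u n) i : mR3 -> R)).
  - by move=> n; exact: L2_Lfun.
  - move=> e /cu[N hN]; exists N => m n Nm Nn; apply: le_lt_trans (hN m n Nm Nn).
    by rewrite HE (bigD1 i)//= lerDl sumr_ge0.
  - by exists (exist _ h hL).
pose w : Lfield D := fun i => sval (lim i).
have uw : hsqdist ipL (Lfield_of (u n)) w @[n --> \oo] --> (0 : R).
  have h : \sum_(i < 3) L2_sqdist D (H_field (u n) i) (sval (w i)) @[n --> \oo] -->
      \sum_(i < 3) (0 : R).
    apply: cvg_big => [|i _]; first exact: add_continuous.
    exact: (svalP (lim i)).
  rewrite big1 in h => //; apply: cvg_trans h.
  by apply: near_eq_cvg; apply: nearW => n; rewrite Lfield_hsqdist.
have [|l lw] := @H_of_Lfield _ _ w.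
  move=> e e0; have e40 : 0 < Num.sqrt e / 2 by rewrite divr_gt0// sqrtr_gt0.
  have [n _ /(_ n (leqnn n)) un] := cvgr_lt _ uw _ (exprn_gt0 2 e40).
  have [phi [sphi hphi]] := H_test_approx (u n) e40.
  exists phi, sphi; rewrite -(@ltr_sqrt _ _ e)//.
  apply: le_lt_trans (distL_triangle _ (Lfield_of (u n)) _) _.
  rewrite (splitr (Num.sqrt e)) ltrD//.
  rewrite (hsqdistC (@Lfield_innerC R D)) -(ger0_norm (ltW e40)) -sqrtr_sqr.
  by rewrite ltr_sqrt// exprn_gt0.
exists l; suff -> : (fun n => hsqdist ipH (u n) l) =
   (fun n => hsqdist ipL (Lfield_of (u n)) w) by [].
apply/funext => n; rewrite /hsqdist !H_innerE lw.
rewrite [ipL _ (Lfield_of l)]Lfield_innerC lw.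
by rewrite [ipL w (Lfield_of l)]Lfield_innerC lw [ipL w _]Lfield_innerC.
Qed.

Let N := sval (cid (dom_in_cube D)).
Let hN := svalP (cid (dom_in_cube D)).

(* Grid of mesh [1 / n.+1] on a cube containing the domain. *)
Let gridT n := 'I_(N.*2 * n.+1).+1.
Let cell1 n (t : R) : gridT n := inord (Num.trunc (n.+1%:R * (t + N%:R))).
Let cell n (x : R3) : gridT n * gridT n * gridT n :=
  (cell1 n x.1.1, cell1 n x.1.2, cell1 n x.2).
Let corner1 n (c : gridT n) : R := (nat_of_ord c)%:R / n.+1%:R - N%:R.
Let corner n (c : gridT n * gridT n * gridT n) : R3 :=
  (corner1 c.1.1, corner1 c.1.2, corner1 c.2).

Let cell1_close n (t : R) : `|t| <= N%:R -> ball t n.+1%:R^-1 (corner1 (cell1 n t)).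
Proof.
rewrite ler_norml => /andP[t1 t2].
have p0 : 0 < n.+1%:R :> R by rewrite ltr0n.
set a := n.+1%:R * (t + N%:R).
have a0 : 0 <= a by rewrite mulr_ge0//; lra.
have /andP[h1 h2] := truncn_itv a0.
have alt : (Num.trunc a < (N.*2 * n.+1).+1)%N.
  rewrite ltnS -(ler_nat R); apply: le_trans h1 _.
  by rewrite /a natrM mulrC ler_wpM2r// -muln2 natrM; lra.
rewrite /ball/= /corner1 /cell1 inordK// -/a.
have -> : t - ((Num.trunc a)%:R / n.+1%:R - N%:R) = (a - (Num.trunc a)%:R) / n.+1%:R.
  by rewrite /a; field; rewrite gt_eqF.
rewrite normrM ger0_norm ?subr_ge0// gtr0_norm ?invr_gt0//.
rewrite -natr1 in h2; rewrite ltr_pdivrMr// mulVf ?gt_eqF//; lra.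
Qed.

(** By uniform continuity on a cube containing the domain, a continuous field is
    uniformly close there to a step function with rational values on a fine grid,
    and there are countably many of these. *)
Lemma test_functions_separable (phi : 'I_3 -> R3 -> R) (e : R) :
  (forall i, continuous (phi i)) -> 0 < e ->
  exists n (l : {ffun 'I_3 * (gridT n * gridT n * gridT n) -> rat}),
    forall i x, dom D x -> `|phi i x - ratr (l (i, cell n x))| < e.
Proof.
move=> cphi e0; have e20 : 0 < e / 2 by lra.
pose I : set R := [set` `[- N%:R, N%:R]].
have cK : compact ((I `*` I) `*` I).
  by do 2 (apply: compact_setX; last exact: segment_compact); exact: segment_compact.
have [n _ /(_ n (leqnn n)) hn] : \forall n \near \oo, forall i x,
    ((I `*` I) `*` I) x -> forall y, ball x n.+1%:R^-1 y -> `|phi i x - phi i y| < e / 2.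
  apply: filter_forall => i.
  exact: compact_uniform_continuity.
have /choice[q hq] (ic : 'I_3 * (gridT n * gridT n * gridT n)) :
    exists q : rat, `|phi ic.1 (corner ic.2) - ratr q| < e / 2.
  have /rat_in_itvoo[q] :
    phi ic.1 (corner ic.2) - e / 2 < phi ic.1 (corner ic.2) + e / 2 by lra.
  rewrite in_itv/= => /andP[? ?]; exists q; rewrite ltr_norml; apply/andP; split; lra.
exists n, [ffun ic => q ic] => i x Dx; rewrite ffunE.
have [x1 x2 x3] := hN Dx.
rewrite (_ : _ - _ = (phi i x - phi i (corner (cell n x))) +
   (phi i (corner (cell n x)) - ratr (q (i, cell n x)))); last by ring.
apply: le_lt_trans (ler_normD _ _) _; rewrite (splitr e) ltrD//; last first.
  exact: (hq (i, cell n x)).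
apply: hn; first by rewrite /I/= !in_itv/= -!ler_norml.
by split; [split|]; exact: cell1_close.
Qed.

(** The step functions are not in [H]: to each of them, and each precision, is
    attached an element of [H] close in mean square to a test field that is
    uniformly close to the step function, if there is one.  Uniform closeness
    implies closeness in mean square as the domain has finite measure. *)
Theorem H_separable : exists e : nat -> H D, forall u (r : R), 0 < r ->
  exists n, Num.sqrt (hsqdist ipH u (e n)) < r.
Proof.
pose Idx : countType :=
  ({n : nat & {ffun 'I_3 * (gridT n * gridT n * gridT n) -> rat}} * nat)%type.
pose s (l : {n : nat & {ffun 'I_3 * (gridT n * gridT n * gridT n) -> rat}}) i x : R :=
  ratr (projT2 l (i, cell (projT1 l) x)).
pose good (j : Idx) (h : H D) := exists phi (sphi : solenoidal_test D phi),
  Num.sqrt (hsqdist ipL (Lfield_of h) (test_Lfield sphi)) < j.2.+1%:R^-1 /\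
  forall i x, dom D x -> `|phi i x - s j.1 i x| < j.2.+1%:R^-1.
pose E (j : Idx) : H D := xget point (good j).
exists (fun n => if unpickle n is Some j then E j else point) => u r r0.
pose m := fine (mu setT).
have m0 : 0 <= m by apply: fine_ge0.
pose c := 2 + 2 * Num.sqrt (3 * m).
have c0 : 0 < c by rewrite ltr_wpDr// mulr_ge0// sqrtr_ge0.
pose k := Num.trunc (c / r).
have kr : c * k.+1%:R^-1 < r.
  by rewrite ltr_pdivrMr// mulrC -ltr_pdivrMr//; exact: truncnS_gt.
set d := k.+1%:R^-1 in kr.
have d0 : 0 < d by rewrite invr_gt0.
have [phi [sphi hphi]] := H_test_approx u d0.
have cphi i : continuous (phi i) by have [/(_ 0%N)] := sphi.1 i.
have [n [l hl]] := test_functions_separable cphi d0.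
pose j : Idx := (existT _ n l, k).
have [psi [spsi [hpsi1 hpsi2]]] : good j (E j).
  by rewrite /E; apply: xgetPex; exists u, phi, sphi.
exists (pickle j); rewrite pickleK.
apply: le_lt_trans kr; rewrite /c.
rewrite -[hsqdist _ _ _]/(hsqdist ipL (Lfield_of u) (Lfield_of (E j))).
apply: le_trans (distL_triangle _ (test_Lfield sphi) _) _.
rewrite (_ : (2 + _) * d = d + (2 * Num.sqrt (3 * m) * d + d)); last by ring.
apply: lerD; first exact: ltW.
apply: le_trans (distL_triangle _ (test_Lfield spsi) _) _.
apply: lerD; last by rewrite (hsqdistC (@Lfield_innerC R D)) ltW.
rewrite Lfield_hsqdist.
have close i x : `|phi i x - psi i x| <= 2 * d.
  have [Dx|nDx] := pselect (dom D x).
    rewrite (_ : phi i x - psi i x =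
      (phi i x - s j.1 i x) - (psi i x - s j.1 i x)); last by ring.
    apply: le_trans (ler_normB _ _) _.
    by have := hl i x Dx; have := hpsi2 i x Dx; rewrite /= -/d /s /=; lra.
  have [_ [K [_ KD phi0]]] := sphi.1 i; have [_ [L [_ LD psi0]]] := spsi.1 i.
  rewrite phi0 ?psi0 ?subrr ?normr0 ?mulr_ge0 ?ltW//.
  - by move=> /LD.
  - by move=> /KD.
have int_le i : L2_sqdist D (phi i) (psi i) <= (2 * d) ^+ 2 * m.
  rewrite /m -Rintegral_cst//; apply: le_Rintegral => //.
  - have h : ((fun x => phi i x - psi i x) : mR3 -> R) \in Lf.
      by apply: Lfun2B; apply: test_function_Lfun2; [exact: sphi.1|exact: spsi.1].
    exact: (Lfun2_integrable_sqr h).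
  - apply: measurable_bounded_integrable => //; first exact: lebesgue_dom_finite.
    exists ((2 * d) ^+ 2); split; first exact: num_real.
    by move=> M hM x _ /=; rewrite ger0_norm ?sqr_ge0//; exact: ltW.
  - move=> x _; rewrite -real_normK ?num_real//.
    by rewrite lerXn2r ?nnegrE// mulr_ge0// ltW.
apply: (@le_trans _ _ (Num.sqrt ((2 * d) ^+ 2 * (3 * m)))).
  rewrite ler_wsqrtr// (@le_trans _ _ (\sum_(i < 3) (2 * d) ^+ 2 * m))//.
    by apply: ler_sum => i _; exact: int_le.
  rewrite sumr_const card_ord -mulr_natl le_eqVlt; apply/orP; left; apply/eqP; ring.
rewrite sqrtrM ?sqr_ge0// sqrtr_sqr ger0_norm; last by rewrite mulr_ge0// ltW.
by rewrite [leLHS](_ : _ = 2 * Num.sqrt (3 * m) * d)//; ring.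
Qed.

End Complete.

(** * Weak topology and the space of trajectories *)

Lemma initial_cvgP {S : choiceType} {T : topologicalType} (f : S -> T)
    (F : set_system S) (s : S) : Filter F ->
  F --> (s : initial_topology f) <-> f @ F --> f s.
Proof.
move=> FF; split=> [Fs|fF].
  by apply: cvg_trans (@initial_continuous _ _ f s); exact: cvg_app.
move=> A [B [[C oC <-] Cs CA]]; apply: filterS CA _; apply: fF.
exact: open_nbhs_nbhs.
Qed.

Lemma ptws_cvgP {I : choiceType} {T : topologicalType}
    (F : set_system {ptws I -> T}) (f : {ptws I -> T}) : Filter F ->
  F --> f <-> forall i, g i @[g --> F] --> f i.
Proof.
move=> FF.
have E := @cvg_sup {ptws I -> T} I (fun i => Topological.class
    (initial_topology (fun f : (forall i : I, T) => f i))) F f FF.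
split=> [/E h i|h].
  by have /(@initial_cvgP _ _ (fun f : (forall i : I, T) => f i)) := h i.
apply/E => i.
by apply/(@initial_cvgP _ _ (fun f : (forall i : I, T) => f i)); exact: h.
Qed.

Section WeakTopology.
Variables (R : realType) (D : bounded_smooth_domain R).
Local Notation ipH := (@H_inner R D).
Import finmap.

Lemma Hw_cvgP {X : Type} (F : set_system X) (phi : X -> Hw D) (u : Hw D) :
  Filter F ->
  phi x @[x --> F] --> u <-> forall v : H D, ipH (phi x) v @[x --> F] --> ipH u v.
Proof.
move=> FF; rewrite (@initial_cvgP _ _ (@H_pairing R D) (phi @ F) u).
by rewrite (@ptws_cvgP (H D) R ((@H_pairing R D) @ (phi @ F)) (H_pairing u)).
Qed.

Lemma Hw_inner_continuous (v : H D) : continuous (fun u : Hw D => ipH u v).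
Proof.
by move=> u; have /(Hw_cvgP id) /(_ v) := @cvg_id _ (nbhs u).
Qed.

Lemma Hw_hausdorff : hausdorff_space (Hw D).
Proof.
move=> x y xy; apply: H_ext => v; apply: (@Rhausdorff R).
move=> A B /(Hw_inner_continuous (x:=x)) xA /(Hw_inner_continuous (x:=y)) yB.
by have [z [Az Bz]] := xy _ _ xA yB; exists (ipH z v).
Qed.

(** The entourages of the weak topology are generated by those of the
    functionals [(., v)]. *)
Lemma Hw_entourage (G : set_system (Hw D * Hw D)) : Filter G ->
  (forall v (e : R), 0 < e -> G [set pq | `|ipH pq.1 v - ipH pq.2 v| < e]) ->
  forall E, entourage E -> G E.
Proof.
move=> GF Gv E [B [C [J _ <-] JB] BE]; apply: filterS BE _.
have : G (\bigcap_(i in [set` J]) [set pq | (projT1 i).2 (H_pairing pq.1, H_pairing pq.2)]).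
  apply: filter_bigI => -[[v W] /= /asboolP [V entV VW]] _.
  move: entV; rewrite -entourage_ballE => -[e /= e0 eV].
  apply: filterS (Gv v e e0) => -[p q] /= pq.
  by apply: VW; apply: eV.
by apply: filterS => pq h; apply: JB => i Ji; exact: (h i Ji).
Qed.

End WeakTopology.

Section Trajectories.
Variables (R : realType) (D : bounded_smooth_domain R).
Local Notation ipH := (@H_inner R D).
Local Notation Cw := (Cw D).

Definition traj (u : Cw) (t : halfline R) : Hw D :=
  (u : continuousType (halfline R) (Hw D)) t.

Lemma at_time_traj (u : Cw) t : at_time u t = traj u (time t).
Proof. by []. Qed.

Lemma timeK (t : halfline R) : time (val t) = t.
Proof.
apply: val_inj => /=; apply/max_idPl.
by have /set_mem := valP t.
Qed.

Lemma time_val (t : R) : 0 <= t -> val (time t) = t.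
Proof. by move=> t0; exact/max_idPl. Qed.

Lemma Cw_cvgP (F : set_system Cw) (u : Cw) : Filter F ->
  F --> u <-> forall (a b : R) (E : set (Hw D * Hw D)), entourage E ->
    \forall h \near F, forall t : halfline R, a <= val t <= b ->
      E (traj u t, traj h t).
Proof.
move=> FF; rewrite (@initial_cvgP _ _ (@Cw_incl R D) F u).
rewrite (@fam_cvgP _ _ (@compact_itvs R) ((@Cw_incl R D) @ F) (Cw_incl u)).
split=> [h a b E entE|h A [a [b ->]] P].
  apply: (h [set t | a <= val t <= b] _
    [set g | forall t, a <= val t <= b -> E (traj u t, g t)]); first by exists a, b.
  by apply/uniform_nbhs; exists E; split.
move=> /uniform_nbhs[E [entE EP]]; have := h a b E entE.
by apply: filterS => w hw; apply: EP.
Qed.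

Lemma at_time_continuous (t : R) : continuous (fun u : Cw => at_time u t : Hw D).
Proof.
move=> u; apply/(cvg_app_entourageP _ (nbhs_filter (u : Cw))) => E entE.
have /(_ (val (time t)) (val (time t)) _ entE) :=
  (Cw_cvgP u (nbhs_filter (u : Cw))).1 (@cvg_id _ (nbhs u)).
by apply: filterS => w; apply; rewrite lexx.
Qed.

Lemma at_time_inner_continuous (t : R) (v : H D) :
  continuous (fun u : Cw => ipH (at_time u t) v).
Proof.
move=> u.
apply: (@continuous_comp _ _ _ (fun u : Cw => at_time u t : Hw D) (fun w => ipH w v)).
  exact: at_time_continuous.
exact: Hw_inner_continuous.
Qed.

Lemma time_continuous : continuous (@time R).
Proof.
apply: continuous_comp_initial => t.
rewrite (_ : _ \o _ = fun s : R => Num.max s 0)//.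
by apply: (@continuous_max _ _ id (cst 0)) => //; exact: cst_continuous.
Qed.

Lemma traj_continuous (u : Cw) (v : H D) :
  continuous (fun t : R => ipH (at_time u t) v).
Proof.
move=> t.
apply: (@continuous_comp _ _ _ (fun t : R => at_time u t : Hw D) (fun w => ipH w v)).
  apply: (@continuous_comp _ _ _ (@time R) (traj u)); first exact: time_continuous.
  exact: cts_fun.
exact: Hw_inner_continuous.
Qed.

Lemma at_time_shift (tau : R) (u : Cw) t : 0 <= tau -> 0 <= t ->
  at_time (Defs.shift tau u) t = at_time u (t + tau).
Proof.
move=> tau0 t0.
by rewrite -[LHS]/(traj u (time (val (time t) + tau))) time_val.
Qed.

Lemma shift_is_continuous (tau : R) : 0 <= tau ->
  continuous (Defs.shift tau : Cw -> Cw).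
Proof.
move=> tau0 u.
apply/(Cw_cvgP _ (fmap_filter _ (nbhs_filter (u : Cw)))) => a b E entE.
have := (Cw_cvgP u (nbhs_filter (u : Cw))).1 (@cvg_id _ (nbhs u))
  (a + tau) (b + tau) E entE.
apply: filterS => w hw t /andP[at_ tb].
apply: (hw (time (val t + tau))).
have t0 : 0 <= val t by have /set_mem := valP t.
by rewrite time_val ?addr_ge0// !lerD2r at_ tb.
Qed.

Lemma measurable_shift (tau : R) : 0 <= tau ->
  measurable_fun setT (Defs.shift tau : borelCw D -> borelCw D).
Proof.
move=> tau0.
apply: (@measurability _ _ (borelCw D) (borelCw D) setT (Defs.shift tau)
  (@open Cw)) => //.
move=> _ [A oA <-]; rewrite setTI; apply: sub_sigma_algebra.
by move: A oA; apply/continuousP; exact: shift_is_continuous.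
Qed.

(** The continuity requirement is one-sided at time 0, where only nonnegative
    times are available. *)
Lemma Cw_of_weakly_continuous (U : R -> H D) :
  (forall v t (e : R), 0 <= t -> 0 < e -> exists2 d : R, 0 < d &
     forall s, 0 <= s -> `|t - s| < d -> `|ipH (U t) v - ipH (U s) v| < e) ->
  exists u : Cw, forall t, 0 <= t -> at_time u t = U t.
Proof.
move=> cU.
have val_ge0 (t : halfline R) : 0 <= val t by have /set_mem := valP t.
have cu : continuous (fun t : halfline R => U (val t) : Hw D).
  move=> t; apply/(Hw_cvgP _ _ (nbhs_filter (t : halfline R))) => v.
  apply/cvgrPdist_lt => e e0.
  have [d d0 hd] := cU v (val t) e (val_ge0 t) e0.
  have vt : val s @[s --> (t : halfline R)] --> val t.
    exact: (@initial_continuous (set_type [set t : R | 0 <= t]) R val t).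
  have /cvgrPdist_lt/(_ d d0) := vt.
  by apply: filterS => s; exact: hd.
exists (mk_Cw cu) => t t0.
by rewrite -[LHS]/(U (val (time t))) time_val.
Qed.

End Trajectories.

(** * Compact sets of trajectories and tightness *)

Section WeakNorm.
Variables (R : realType) (D : bounded_smooth_domain R).
Local Notation ipH := (@H_inner R D).
Local Notation normH := (hnorm ipH).

(** Expressing the norm by inner products makes its sublevel sets weakly
    closed. *)
Lemma hnorm_le_weak (x : H D) (c : R) : 0 <= c ->
  (forall v, `|ipH x v| <= c * normH v) -> normH x <= c.
Proof.
move=> c0 h; have := h x.
rewrite ger0_norm ?H_inner_ge0// -sqr_H_norm expr2.
have [->//|x0] := eqVneq (normH x) 0.
by rewrite ler_pM2r// lt_neqAle eq_sym x0 hnorm_ge0.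
Qed.

(** For bounded vectors it suffices to control the inner products with a strongly
    dense family. *)
Lemma inner_approx (x y v w : H D) (M : R) : normH x <= M -> normH y <= M ->
  `|ipH x v - ipH y v| <=
  `|ipH x w - ipH y w| + 2 * M * Num.sqrt (hsqdist ipH v w).
Proof.
move=> xM yM.
have lip z : normH z <= M ->
    `|ipH z v - ipH z w| <= M * Num.sqrt (hsqdist ipH v w).
  move=> zM; rewrite !(H_innerC z).
  apply: le_trans (H_inner_sub_le _ _ _) _.
  by rewrite mulrC ler_wpM2r// sqrtr_ge0.
have := lip x xM; have := lip y yM.
set a := `|ipH x v - _|; set b := `|ipH y v - _| => hb ha.
have -> : ipH x v - ipH y v =
  (ipH x w - ipH y w) + ((ipH x v - ipH x w) - (ipH y v - ipH y w)) by ring.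
apply: le_trans (ler_normD _ _) _; rewrite lerD2l.
apply: le_trans (ler_normB _ _) _; move: ha hb; rewrite /a /b; lra.
Qed.

End WeakNorm.

Section CompactTrajectories.
Variables (R : realType) (D : bounded_smooth_domain R).
Local Notation ipH := (@H_inner R D).
Local Notation normH := (hnorm ipH).
Local Notation Cw := (Cw D).
Variable e : nat -> H D.
Hypothesis e_dense : forall u (r : R), 0 < r ->
  exists n, Num.sqrt (hsqdist ipH u (e n)) < r.

Definition bounded_traj (n j : nat) : set Cw :=
  [set u | forall t : R, 0 <= t <= n%:R -> normH (at_time u t) <= j%:R].

Definition equicont_traj (n k m j : nat) : set Cw :=
  [set u | forall s t : R, 0 <= s <= n%:R -> 0 <= t <= n%:R ->
     ball s j.+1%:R^-1 t ->
     `|ipH (at_time u s) (e k) - ipH (at_time u t) (e k)| <= m.+1%:R^-1].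

Lemma closed_bounded_traj n j : closed (bounded_traj n j).
Proof.
have -> : bounded_traj n j = \bigcap_(t in [set t : R | 0 <= t <= n%:R])
    \bigcap_(v in [set: H D])
      ((fun u : Cw => ipH (at_time u t) v) @^-1`
         [set` `[- (j%:R * normH v), j%:R * normH v]]).
  apply/seteqP; split=> u hu.
    move=> t tn v _ /=; rewrite in_itv/= -ler_norml.
    apply: le_trans (H_cauchy_schwarz _ _) _.
    by rewrite ler_wpM2r ?hnorm_ge0//; exact: hu.
  move=> t tn; apply: hnorm_le_weak => // v.
  by have := hu t tn v I; rewrite /= in_itv/= -ler_norml.
apply: closed_bigI => t _; apply: closed_bigI => v _.
apply: closed_comp => [u _|]; first exact: at_time_inner_continuous.
exact: interval_closed.
Qed.

Lemma closed_equicont_traj n k m j : closed (equicont_traj n k m j).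
Proof.
pose P (st : R * R) := [/\ 0 <= st.1 <= n%:R, 0 <= st.2 <= n%:R & ball st.1 j.+1%:R^-1 st.2].
have -> : equicont_traj n k m j = \bigcap_(st in P)
   ((fun u : Cw => ipH (at_time u st.1) (e k) - ipH (at_time u st.2) (e k))
      @^-1` [set` `[- m.+1%:R^-1, m.+1%:R^-1]]).
  apply/seteqP; split=> u hu.
    by move=> [s t] [/= sn tn st]; rewrite /= in_itv/= -ler_norml; exact: hu.
  by move=> s t sn tn st; have := hu (s, t) (And3 sn tn st); rewrite /= in_itv/= -ler_norml.
apply: closed_bigI => st _; apply: closed_comp => [u _|]; last exact: interval_closed.
exact: (cvgB (@at_time_inner_continuous R D st.1 (e k) u)
  (@at_time_inner_continuous R D st.2 (e k) u)).
Qed.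

Lemma equicont_traj_homo n k m i j : (i <= j)%N ->
  equicont_traj n k m i `<=` equicont_traj n k m j.
Proof.
move=> ij u hu s t sn tn st; apply: hu => //; apply: le_ball st.
by rewrite lef_pV2 ?posrE// ler_nat.
Qed.

Lemma equicont_traj_cover (u : Cw) n k m : exists j, equicont_traj n k m j u.
Proof.
have m0 : 0 < m.+1%:R^-1 :> R by rewrite invr_gt0.
have := compact_uniform_continuity (@segment_compact R 0 n%:R)
  (@traj_continuous R D u (e k)) m0.
move=> [j _ /(_ j (leqnn j)) hj]; exists j => s t sn tn st.
by apply/ltW/hj => //; rewrite /= in_itv.
Qed.

Variables (M : nat -> nat) (J : nat -> nat -> nat -> nat).

Definition controlled_traj : set Cw :=
  [set u | (forall n, bounded_traj n (M n) u) /\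
           (forall n k m, equicont_traj n k m (J n k m) u)].

(** Arzela-Ascoli: an ultrafilter of such trajectories converges weakly at each
    time by weak compactness of balls, and the common moduli of continuity, applied
    on a finite grid of times, make the convergence uniform on bounded intervals. *)
Theorem compact_controlled_traj : compact controlled_traj.
Proof.
rewrite compact_ultra => F UF FK.
have nof (t : R) : 0 <= t -> exists2 n : nat, t <= n%:R & (0 < n)%N.
  move=> t0; exists (Num.trunc t).+1 => //; exact/ltW/truncnS_gt.
have wlim (t : R) : exists U : H D, 0 <= t ->
    (forall n : nat, t <= n%:R -> normH U <= (M n)%:R) /\
    forall v, ipH (at_time u t) v @[u --> F] --> ipH U v.
  have [t0|t0] := leP 0 t; last by exists point; lra.
  have FM n : t <= n%:R -> F [set u | normH (at_time u t) <= (M n)%:R].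
    by move=> tn; apply: filterS FK => u [+ _]; apply; rewrite t0.
  have [n0 tn0 _] := nof t t0.
  have [U _ UF'] := weak_ball_ultra_cvg (@H_innerC R D) (@H_inner_comb R D)
    (@H_inner_ge0 R D) (@H_complete R D) UF (ler0n R (M n0)) (FM n0 tn0).
  exists U => _; split=> // n tn.
  apply: hnorm_le_weak => // v.
  apply: (cvgr_to_le (cvg_norm (UF' v))).
  apply: filterS (FM n tn) => u hu.
  apply: le_trans (H_cauchy_schwarz _ _) _.
  by rewrite ler_wpM2r ?hnorm_ge0.
have {wlim} /choice[U hU] := wlim.
have UM (t : R) n : 0 <= t <= n%:R -> normH (U t) <= (M n)%:R.
  by move=> /andP[t0 tn]; exact: (hU t t0).1.
have Ucvg (t : R) v : 0 <= t -> ipH (at_time u t) v @[u --> F] --> ipH (U t) v.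
  by move=> t0; exact: (hU t t0).2.
have Uequi n k m (s t : R) : 0 <= s <= n%:R -> 0 <= t <= n%:R ->
    ball s (J n k m).+1%:R^-1 t -> `|ipH (U s) (e k) - ipH (U t) (e k)| <= m.+1%:R^-1.
  move=> sn tn st; have /andP[s0 _] := sn; have /andP[t0 _] := tn.
  have h : `|ipH (at_time u s) (e k) - ipH (at_time u t) (e k)| @[u --> F] -->
      `|ipH (U s) (e k) - ipH (U t) (e k)|.
    by apply: cvg_norm; apply: cvgB; exact: Ucvg.
  apply: (cvgr_to_le h).
  by apply: filterS FK => u [_ hu]; exact: (hu n k m s t sn tn st).
have small (r : R) : 0 < r -> exists m : nat, m.+1%:R^-1 < r.
  move=> r0; exists (Num.trunc r^-1).
  by rewrite -[ltRHS]invrK ltf_pV2 ?posrE ?invr_gt0// truncnS_gt.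
have appr n v (r : R) : 0 < r -> exists k, 2 * (M n)%:R * Num.sqrt (hsqdist ipH v (e k)) < r.
  move=> r0; have p : 0 < 2 * (M n)%:R + 1 :> R by rewrite ltr_wpDl// mulr_ge0.
  have [k hk] := e_dense v (divr_gt0 r0 p); exists k.
  have s0 := sqrtr_ge0 (hsqdist ipH v (e k)).
  rewrite ltr_pdivlMr// in hk; apply: le_lt_trans hk.
  by rewrite mulrC ler_wpM2l// lerDl.
have [W WU] : exists W : Cw, forall t, 0 <= t -> at_time W t = U t.
  apply: Cw_of_weakly_continuous => v t r t0 r0.
  have [n tn _] := nof (t + 1) (addr_ge0 t0 ler01).
  have r20 : 0 < r / 2 by lra.
  have [k hk] := appr n v (r / 2) r20; have [m hm] := small (r / 2) r20.
  exists (Num.min 1 (J n k m).+1%:R^-1); first by rewrite lt_min ltr01 invr_gt0 ltr0n.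
  move=> s s0; rewrite lt_min => /andP[ts1 ts].
  have sn : 0 <= s <= n%:R.
    by rewrite s0/= (le_trans _ tn)//; move: ts1; rewrite ltr_norml => /andP[]; lra.
  have tn' : 0 <= t <= n%:R by rewrite t0/=; lra.
  apply: le_lt_trans (inner_approx v (e k) (UM _ _ tn') (UM _ _ sn)) _.
  have := Uequi n k m t s tn' sn ts; move: hk hm; move: (m.+1%:R^-1) => q; lra.
exists W; split.
  split=> [n t tn|n k m s t sn tn st].
    by have /andP[t0 _] := tn; rewrite WU//; exact: UM.
  have /andP[s0 _] := sn; have /andP[t0 _] := tn.
  rewrite WU// WU//; exact: (Uequi n k m s t sn tn st).
apply/Cw_cvgP => a b.
(* The relations that eventually hold between [W] and [h], at all times in
   [[a, b]], form a filter, so that basic entourages suffice. *)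
pose G : set_system (Hw D * Hw D) := [set E |
  \forall h \near F, forall t : halfline R, a <= val t <= b -> E (traj W t, traj h t)].
have FG : Filter G.
  split.
  - by apply: nearW.
  - move=> P Q GP GQ; apply: (@filterS2 _ F _ _ _ _ _ GP GQ) => h hP hQ t tab.
    by split; [exact: hP|exact: hQ].
  - move=> P Q PQ; apply: (@filterS _ F) => h hP t tab; apply: PQ; exact: hP.
suff Gv v (r : R) : 0 < r -> G [set pq | `|ipH pq.1 v - ipH pq.2 v| < r].
  by move=> E; exact: (Hw_entourage FG Gv).
move=> r0.
have [n bn _] : exists2 n : nat, b <= n%:R & (0 < n)%N.
  have [b0|b0] := leP 0 b; first exact: nof.
  by exists 1%N => //; lra.
have r20 : 0 < r / 2 by lra.
have r80 : 0 < r / 8 by lra.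
have [k hk] := appr n v (r / 2) r20; have [m hm] := small (r / 8) r80.
pose N := (J n k m).+1.
pose g (i : nat) : R := i%:R / N%:R.
have Npos : 0 < N%:R :> R by rewrite ltr0n.
have g0 i : 0 <= g i by rewrite divr_ge0.
(* On the grid of mesh [1 / N] the convergence is uniform, being required at
   finitely many times only. *)
have near_grid : \forall h \near F, forall i : 'I_(n * N).+1,
    `|ipH (U (g i)) (e k) - ipH (at_time h (g i)) (e k)| < r / 8.
  apply: filter_forall => i.
  by have /cvgrPdist_lt/(_ _ r80) := Ucvg (g i) (e k) (g0 i).
apply: filterS2 FK near_grid => h hK hgrid t /andP[_ tb].
have t0 : 0 <= val t by have /set_mem := valP t.
have tn : 0 <= val t <= n%:R by rewrite t0/= (le_trans tb).
have Wt : traj W t = U (val t) by rewrite -(WU _ t0) at_time_traj timeK.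
have ht : traj h t = at_time h (val t) by rewrite at_time_traj timeK.
rewrite /= Wt ht.
have hM : normH (at_time h (val t)) <= (M n)%:R by exact: hK.1.
apply: le_lt_trans (inner_approx v (e k) (UM _ _ tn) hM) _.
pose i := Num.trunc (val t * N%:R).
have tN0 : 0 <= val t * N%:R by rewrite mulr_ge0.
have /andP[i1 i2] := truncn_itv tN0; rewrite -/i in i1 i2.
have iN : (i < (n * N).+1)%N.
  rewrite ltnS -(ler_nat R); apply: le_trans i1 _.
  by rewrite natrM ler_wpM2r//; case/andP: tn.
have git : g i <= val t by rewrite ler_pdivrMr.
have gn : 0 <= g i <= n%:R by rewrite g0/= (le_trans git)//; case/andP: tn.
have bl : ball (val t) N%:R^-1 (g i).
  rewrite /ball/= ger0_norm ?subr_ge0//.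
  rewrite -natr1 in i2; rewrite /g ltrBlDr -[X in X + _]mul1r -mulrDl ltr_pdivlMr//.
  by rewrite addrC.
have := Uequi n k m _ _ tn gn bl; have := hK.2 n k m _ _ tn gn bl.
have /= := hgrid (Ordinal iN).
set x1 := ipH (U (val t)) _; set x2 := ipH (U (g i)) _.
set y1 := ipH (at_time h (val t)) _; set y2 := ipH (at_time h (g i)) _.
move=> h1 h2 h3.
have -> : x1 - y1 = (x1 - x2) + (x2 - y2) - (y1 - y2) by ring.
have := ler_normB (x1 - x2 + (x2 - y2)) (y1 - y2).
have := ler_normD (x1 - x2) (x2 - y2).
move: h1 h2 h3 hm hk; move: (m.+1%:R^-1) => q; lra.
Qed.

End CompactTrajectories.

(** Choose the [n]-th index so that the [n]-th set misses at most [e / 2^(n+1)]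
    of the mass. *)
Lemma probability_bigcap_large {d} {T : measurableType d} {R : realType}
    (P : probability T R) {I : countType} (A : I -> nat -> set T) (e : R) :
  (forall i j, measurable (A i j)) ->
  (forall i j, A i j `<=` A i j.+1) ->
  (forall i, P (\bigcap_j ~` A i j) = 0%E) -> 0 < e ->
  exists J : I -> nat, (P (~` \bigcap_i A i (J i)) <= e%:E)%E.
Proof.
move=> mA homoA A0 e0.
have /choice[J hJ] (n : nat) : exists j, forall i, unpickle n = Some i ->
    (P (~` A i j) < (e / (2 ^ n.+1)%:R)%:E)%E.
  have en : 0 < e / (2 ^ n.+1)%:R by rewrite divr_gt0// ltr0n expn_gt0.
  case: (unpickle n) => [i|]; last by exists 0%N.
  have [j hj] : exists j, (P (~` A i j) < (e / (2 ^ n.+1)%:R)%:E)%E.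
    apply: decreasing_probability_small => //.
    - by move=> j; exact: measurableC.
    - by move=> j x nA Ax; apply: nA; exact: homoA.
  by exists j => _ [<-].
exists (fun i => J (pickle i)).
pose B n := if unpickle n is Some i then ~` A i (J n) else set0.
have mB n : measurable (B n).
  by rewrite /B; case: (unpickle n) => // i; exact: measurableC.
apply: (@le_trans _ _ (\sum_(0 <= n <oo) P (B n))%E); last first.
  apply: le_trans (epsilon_trick0 predT (ltW e0)).
  apply: lee_nneseries => // n _; rewrite /B.
  case E : (unpickle n) => [i|]; first exact/ltW/hJ.
  by rewrite measure0 lee_fin divr_ge0// ltW.
apply: measure_sigma_subadditive => //.
- rewrite setC_bigcap bigcup_mkcond; apply: countable_bigcupT_measurable => // i.
  by case: ifP => // _; exact: measurableC.
- move=> x; move/existsNP => [i /not_implyP [_ nAi]].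
  by exists (pickle i) => //; rewrite /B pickleK.
Qed.

Section Tightness.
Variables (R : realType) (D : bounded_smooth_domain R).
Local Notation ipH := (@H_inner R D).
Local Notation normH := (hnorm ipH).
Local Notation Cw := (Cw D).
Variable e : nat -> H D.
Hypothesis e_dense : forall u (r : R), 0 < r ->
  exists n, Num.sqrt (hsqdist ipH u (e n)) < r.

Lemma inner_dense_ext (x y : H D) : (forall k, ipH x (e k) = ipH y (e k)) -> x = y.
Proof.
move=> xy; apply: H_ext => v; apply/eqP; rewrite -subr_eq0 -normr_le0.
apply/ler_addgt0Pr => r r0; rewrite add0r.
pose M := Num.max (normH x) (normH y).
have M0 : 0 <= M by rewrite le_max hnorm_ge0.
have p : 0 < 2 * M + 1 by lra.
have [k hk] := e_dense v (divr_gt0 r0 p).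
have h := @inner_approx _ _ x y v (e k) M.
apply: le_trans (h _ _) _; rewrite ?le_max ?lexx ?orbT//.
rewrite xy subrr normr0 add0r.
rewrite ltr_pdivlMr// in hk; apply: le_trans (ltW hk).
by rewrite mulrC ler_wpM2l ?sqrtr_ge0//; lra.
Qed.

Definition sample (n : nat) (u : Cw) : R :=
  let: (q, k) := odflt (0, 0%N) (unpickle n : option (rat * nat)) in
  ipH (at_time u (ratr q)) (e k).

Lemma sample_continuous n : continuous (sample n).
Proof. by rewrite /sample; case: (odflt _ _) => q k; exact: at_time_inner_continuous. Qed.

(** A trajectory is determined by its coordinates along a dense sequence at
    rational times, being weakly continuous. *)
Lemma sample_separates (u w : Cw) : (forall n, sample n u = sample n w) -> u = w.
Proof.
move=> uw.
have rat_eq (q : rat) k : ipH (at_time u (ratr q)) (e k) = ipH (at_time w (ratr q)) (e k).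
  by have := uw (pickle (q, k)); rewrite /sample pickleK.
have all_eq (t : R) k : ipH (at_time u t) (e k) = ipH (at_time w t) (e k).
  pose f s := ipH (at_time u s) (e k) - ipH (at_time w s) (e k).
  have cf : continuous f.
    by move=> s; apply: cvgB; exact: traj_continuous.
  apply/eqP; rewrite -subr_eq0; apply/negPn/negP => ft.
  have of_ : open (f @^-1` [set r | r != 0]).
    by apply: open_comp => [s _|]; [exact: cf|exact: open_neq].
  have [|s [fs [q _ qs]]] := dense_rat _ of_.
    by exists t.
  by move: fs; rewrite /= -qs /f rat_eq subrr eqxx.
have tr : forall t, traj u t = traj w t.
  move=> t; rewrite -(timeK t) -!at_time_traj.
  by apply: inner_dense_ext => k; exact: all_eq.
exact/continuousEP.
Qed.

Variable rho : probability (borelCw D) R.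
Hypothesis rho_bounded : forall n, rho (\bigcap_j ~` bounded_traj n j) = 0%E.

Lemma controlled_traj_tight (r : R) : 0 < r ->
  exists2 K : set Cw, compact K & (rho (~` K : set (borelCw D)) < r%:E)%E.
Proof.
move=> r0; have r20 : 0 < r / 2 by lra.
(* The norm bounds and the moduli of continuity as a single countable family
   of constraints, which weaken as [j] grows. *)
pose A (i : nat + nat * nat * nat) (j : nat) : set (borelCw D) :=
  match i with
  | inl n => bounded_traj n j
  | inr (n, k, m) => equicont_traj e n k m j
  end.
have [||||J hJ] := @probability_bigcap_large _ _ _ rho _ A (r / 2).
- move=> [n|[[n k] m]] j; apply: closed_measurable.
    exact: closed_bounded_traj.
  exact: closed_equicont_traj.
- move=> [n|[[n k] m]] j; last exact: equicont_traj_homo.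
  by move=> u hu t tn; apply: le_trans (hu t tn) _; rewrite ler_nat.
- move=> [n|[[n k] m]]; first exact: rho_bounded.
  rewrite (_ : \bigcap_j _ = set0) ?measure0//.
  apply/seteqP; split=> // u hu.
  by have [j] := equicont_traj_cover e u n k m; exact: hu.
- exact: r20.
exists (controlled_traj e (fun n => J (inl n)) (fun n k m => J (inr (n, k, m)))).
  exact: compact_controlled_traj.
rewrite (_ : controlled_traj _ _ _ = \bigcap_i A i (J i)).
  by apply: le_lt_trans hJ _; rewrite lte_fin; lra.
apply/seteqP; split=> u.
  by move=> [h1 h2] [n|[[n k] m]] _ /=; [exact: h1|exact: h2].
move=> h; split; first by move=> n; exact: (h (inl n) I).
by move=> n k m; exact: (h (inr (n, k, m)) I).
Qed.

Theorem Cw_inner_compact (A : set (borelCw D)) (r : R) : measurable A -> 0 < r ->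
  exists C : set Cw, [/\ compact C, C `<=` A & (rho (A `\` C) < r%:E)%E].
Proof.
exact: (borel_inner_compact sample_continuous sample_separates controlled_traj_tight).
Qed.

End Tightness.

(** * Joint measurability of evaluation *)

Section EvaluationMeasurable.
Variables (R : realType) (D : bounded_smooth_domain R).
Local Notation ipH := (@H_inner R D).
Local Notation normH := (hnorm ipH).
Local Notation Cw := (Cw D).
Variable e : nat -> H D.
Hypothesis e_dense : forall u (r : R), 0 < r ->
  exists n, Num.sqrt (hsqdist ipH u (e n)) < r.

Lemma hnorm_sub_le (u v : H D) : normH v <= normH u + Num.sqrt (hsqdist ipH u v).
Proof.
rewrite -lerBlDl; have [h|h] := leP (normH v - normH u) 0.
  exact: le_trans h (sqrtr_ge0 _).
rewrite -(ger0_norm (ltW h)) -sqrtr_sqr ler_wsqrtr// /hsqdist.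
rewrite -!sqr_H_norm sqrrB.
have := H_cauchy_schwarz u v.
rewrite ler_norml => /andP[_]; lra.
Qed.

(** A closed ball is an intersection of countably many weakly closed half-spaces:
    it suffices to test against the dense sequence. *)
Lemma dist_le_weak (x y : H D) (r : R) : 0 <= r ->
  (forall j, `|ipH x (e j) - ipH y (e j)| <= r * normH (e j)) ->
  Num.sqrt (hsqdist ipH x y) <= r.
Proof.
move=> r0 h; pose z := H_comb (-1) y x.
have zE v : ipH z v = ipH x v - ipH y v by rewrite H_inner_comb; ring.
have zz : ipH z z = hsqdist ipH x y.
  by rewrite zE !(H_innerC _ z) !zE /hsqdist [ipH y x]H_innerC; ring.
rewrite -zz -/(normH z); apply: hnorm_le_weak => // v.
apply/ler_addgt0Pr => s s0.
pose M := normH z; have M0 : 0 <= M := hnorm_ge0 _ _.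
have p : 0 < M + r + 1 by lra.
have [k hk] := e_dense v (divr_gt0 s0 p).
set t := Num.sqrt _ in hk.
have t0 : 0 <= t := sqrtr_ge0 _.
have lip : `|ipH z v - ipH z (e k)| <= t * M.
  rewrite !(H_innerC z); exact: H_inner_sub_le.
have n1 := hnorm_sub_le v (e k).
have h1 := h k; rewrite -zE in h1.
have -> : ipH z v = ipH z (e k) + (ipH z v - ipH z (e k)) by ring.
apply: le_trans (ler_normD _ _) _.
apply: (@le_trans _ _ (r * (normH v + t) + t * M)).
  by apply: lerD => //; apply: le_trans h1 _; rewrite ler_wpM2l.
rewrite ltr_pdivlMr// in hk.
by rewrite mulrDr -addrA lerD2l; move: hk; lra.
Qed.

Lemma weak_of_dist_le (x y : H D) (r : R) v :
  Num.sqrt (hsqdist ipH x y) <= r -> `|ipH x v - ipH y v| <= r * normH v.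
Proof.
move=> xy; apply: le_trans (H_inner_sub_le _ _ _) _.
by rewrite ler_wpM2r// hnorm_ge0.
Qed.

Let T2 := (measurableTypeR R * borelCw D)%type.

(** An intersection, over uncountably many times, of closed conditions. *)
Lemma measurable_closed_halfspace (p q : R) c v :
  measurable ([set u | forall s, p <= s <= q -> c <= ipH (at_time u s) v] : set (borelCw D)).
Proof.
apply: closed_measurable.
rewrite (_ : [set u | _] = \bigcap_(s in [set s | p <= s <= q])
   ((fun u : Cw => ipH (at_time u s) v) @^-1` [set` `[c, +oo[])); last first.
  by apply/seteqP; split=> u hu s /hu; rewrite /= in_itv/= andbT.
apply: closed_bigI => s _; apply: closed_comp => [u _|]; last exact: interval_closed.
exact: at_time_inner_continuous.
Qed.

(** By continuity in time, the inner product exceeds [c] at time [t] if and only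
    if it stays above some [c + 1 / n.+1] on an interval with rational ends around
    [t]; for a fixed interval this is a closed condition on the trajectory. *)
Lemma measurable_at_time_inner v :
  measurable_fun setT (fun z : T2 => ipH (at_time z.2 z.1) v).
Proof.
apply: (measurability _ (RGenOInfty.measurableE R)).
move=> /= _ [_ [c ->]] <-; rewrite setTI.
pose B (i : rat * rat * nat) : set T2 :=
  [set` `](ratr i.1.1 : R), (ratr i.1.2 : R)[] `*`
  [set u | forall s, ratr i.1.1 <= s <= ratr i.1.2 ->
             c + i.2.+1%:R^-1 <= ipH (at_time u s) v].
rewrite (_ : _ @^-1` _ = \bigcup_i B i); last first.
  apply/seteqP; split=> [[t u]|[t u] [[[p q] n] _ [/= tpq hu]]]/=; rewrite in_itv/= andbT; last first.
    have := hu t; rewrite in_itv/= in tpq.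
    case/andP : tpq => /ltW -> /ltW -> /(_ isT).
    by apply: lt_le_trans; rewrite ltrDl invr_gt0.
  move=> cg; set g := fun t => ipH (at_time u t) v.
  pose d := ipH (at_time u t) v - c.
  have d0 : 0 < d by rewrite subr_gt0.
  have d20 : 0 < d / 2 by lra.
  have /cvgrPdist_lt/(_ _ d20)/nbhs_ballP[r /= r0 hr] := @traj_continuous R D u v t.
  have [p] : exists p : rat, ratr p \in `]t - r, t[ by apply: rat_in_itvoo; lra.
  have [q] : exists q : rat, ratr q \in `]t, t + r[ by apply: rat_in_itvoo; lra.
  rewrite !in_itv/= => /andP[q1 q2] /andP[p1 p2].
  exists (p, q, Num.trunc (d / 2)^-1) => //; split => /=.
    by rewrite in_itv/= p2 q1.
  move=> s /andP[ps sq].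
  have : `|g t - g s| < d / 2.
    by apply: hr; rewrite /ball/= ltr_norml; apply/andP; split; lra.
  have : (Num.trunc (d / 2)^-1).+1%:R^-1 < d / 2.
    by rewrite -[ltRHS]invrK ltf_pV2 ?posrE ?invr_gt0// truncnS_gt.
  move: (_.+1%:R^-1) => w; rewrite ltr_norml => hw /andP[_].
  by rewrite /g /d in hw *; lra.
rewrite bigcup_mkcond; apply: countable_bigcupT_measurable => // i.
case: ifP => // _; apply: measurableX; first exact: measurable_itv.
exact: measurable_closed_halfspace.
Qed.

(** By separability a norm-open set is a countable union of closed balls. *)
Theorem measurable_at_time :
  measurable_fun setT (fun z : T2 => (at_time z.2 z.1 : borelH D)).
Proof.
apply: (@measurability _ _ T2 (borelH D) setT _ (@H_open R D)) => //.
move=> _ [A oA <-]; rewrite setTI.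
pose ball_ k m : set (H D) := [set u | Num.sqrt (hsqdist ipH u (e k)) <= m.+1%:R^-1].
have AE : A = \bigcup_(i in [set i : nat * nat | ball_ i.1 i.2 `<=` A]) ball_ i.1 i.2.
  apply/seteqP; split=> [u Au|u [i /= iA]]; last exact: iA.
  have [r r0 rA] := oA u Au.
  have r20 : 0 < r / 2 by lra.
  pose m := Num.trunc (r / 2)^-1.
  have mr : m.+1%:R^-1 < r / 2.
    by rewrite -[ltRHS]invrK ltf_pV2 ?posrE ?invr_gt0// truncnS_gt.
  have m0 : 0 < m.+1%:R^-1 :> R by rewrite invr_gt0.
  have [k hk] := e_dense u m0.
  exists (k, m) => /=; last exact: ltW.
  move=> w wk; apply: rA; rewrite /= L2_distE.
  apply: le_lt_trans (H_dist_triangle _ (e k) _) _.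
  rewrite (splitr r) ltrD//; first exact: lt_trans mr.
  by rewrite H_sqdistC (le_lt_trans wk).
have mball k m : measurable ([set z : T2 | ball_ k m (at_time z.2 z.1)] : set T2).
  rewrite (_ : [set z | _] = \bigcap_j ((fun z : T2 => ipH (at_time z.2 z.1) (e j)) @^-1`
     [set` `[ipH (e k) (e j) - m.+1%:R^-1 * normH (e j),
             ipH (e k) (e j) + m.+1%:R^-1 * normH (e j)]])).
    apply: bigcap_measurable => // j _.
    by rewrite -[X in measurable X]setTI; apply: measurable_at_time_inner.
  apply/seteqP; split=> [z hz j _|z hz].
    have := weak_of_dist_le (e j) hz.
    by rewrite /= in_itv/= ler_distl.
  apply: dist_le_weak => // j.
  by have := hz j I; rewrite /= in_itv/= ler_distl.
rewrite AE preimage_bigcup bigcup_mkcond.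
by apply: countable_bigcupT_measurable => // i; case: ifP => // _; exact: mball.
Qed.

End EvaluationMeasurable.

(** * Time averages along trajectories *)

Section TimeIntegrals.
Variable R : realType.
Local Notation leb := (@lebesgue_measure R).

(** Lebesgue measure is determined by its values on half-open intervals. *)
Lemma lebesgue_measure_translation (c : R) (A : set (measurableTypeR R)) :
  measurable A ->
  pushforward leb (fun t : R => t + c : measurableTypeR R) A = leb A.
Proof.
have mc : measurable_fun setT (fun t : R => t + c) by exact: measurable_funD.
move=> mA; apply/esym.
apply: (@lebesgue_measure_unique R
  (pushforward leb (fun t : R => t + c : measurableTypeR R))) => //.
move=> _ [[a b] _ <-]; rewrite /pushforward.
have pre : (fun t : R => t + c) @^-1` [set` `]a, b]] = [set` `]a - c, b - c]].
  by apply/seteqP; split=> t /=; rewrite !in_itv/= ltrBlDr lerBrDr.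
transitivity (leb [set` `]a - c, b - c]]); last by rewrite -pre.
by rewrite !lebesgue_measure_itv/= !lte_fin ltrD2r -!EFinB; congr (if _ then _%:E else _); ring.
Qed.

Variables (f : R -> R) (C : R).
Hypothesis mf : measurable_fun setT (f : measurableTypeR R -> R).
Hypothesis fC : forall t, `|f t| <= C.

Lemma bounded_integrable_itv (i : interval R) :
  (leb [set` i] < +oo)%E -> leb.-integrable [set` i] (EFin \o f).
Proof.
move=> ifin; apply: measurable_bounded_integrable => //.
  exact: measurable_funTS.
exists C; split; first exact: num_real.
by move=> M CM t _; apply: le_trans (fC t) (ltW CM).
Qed.

Lemma itv_finite (b1 b2 : bool) (a b : R) :
  (leb [set` Interval (BSide b1 a) (BSide b2 b)] < +oo)%E.
Proof. by rewrite lebesgue_measure_itv; case: ifP => _; rewrite ?ltry. Qed.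

Lemma Rintegral_translation (a b c : R) :
  \int[leb]_(t in `[a + c, b + c]) f t = \int[leb]_(t in `[a, b]) f (t + c).
Proof.
have mc : measurable_fun setT (fun t : R => t + c) by exact: measurable_funD.
rewrite /Rintegral; congr fine.
have pre : (fun t : R => t + c) @^-1` `[a + c, b + c] = [set` `[a, b]].
  by apply/seteqP; split=> t /=; rewrite !in_itv/= !lerD2r.
have mf' : measurable_fun setT (EFin \o f : measurableTypeR R -> \bar R).
  exact/measurable_EFinP.
have intf : leb.-integrable ((fun t : R => t + c) @^-1` `[a + c, b + c])
    ((EFin \o f) \o (fun t : R => t + c)).
  rewrite pre; suff : leb.-integrable [set` `[a, b]] (EFin \o (fun t => f (t + c))) by [].
  apply: measurable_bounded_integrable => //.
  - exact: itv_finite.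
  - by apply: measurable_funTS; exact: measurableT_comp.
  - exists C; split; first exact: num_real.
    by move=> M CM t _; apply: le_trans (fC _) (ltW CM).
have mI : measurable ([set` `[a + c, b + c]] : set (measurableTypeR R)).
  exact: measurable_itv.
transitivity (\int[pushforward leb (fun t : R => (t + c)%R : measurableTypeR R)]_
  (t in `[(a + c)%R, (b + c)%R]) (EFin \o f) t)%E.
  by apply: eq_measure_integral => A mA _; exact/esym/lebesgue_measure_translation.
rewrite (@integral_pushforward _ _ (measurableTypeR R) (measurableTypeR R) R
  (fun t : R => t + c) mc leb [set` `[a + c, b + c]] (EFin \o f) mf' intf mI).
by rewrite pre.
Qed.

Lemma Rintegral_itvD (a b c : R) : a <= b -> b <= c ->
  \int[leb]_(t in `[a, c]) f t =
  \int[leb]_(t in `[a, b]) f t + \int[leb]_(t in `[b, c]) f t.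
Proof.
move=> ab bc.
have := @Rintegral_itvB R f (BLeft a) (BRight c) b
  (bounded_integrable_itv (itv_finite _ _ _ _)).
rewrite !bnd_simp => /(_ ab bc).
rewrite Rintegral_itv_obnd_cbnd; last exact: bounded_integrable_itv (itv_finite _ _ _ _).
by move=> <-; ring.
Qed.

Lemma Rintegral_itv_le (a b : R) : a <= b ->
  `|\int[leb]_(t in `[a, b]) f t| <= C * (b - a).
Proof.
move=> ab; apply: le_trans (le_normr_Rintegral _ _) _ => //.
  exact: bounded_integrable_itv (itv_finite _ _ _ _).
have E : fine (leb `[a, b]) = b - a.
  rewrite lebesgue_measure_itv/= lte_fin; move: ab; rewrite le_eqVlt => /predU1P[->|ab].
    by rewrite ltxx subrr.
  by rewrite ab.
rewrite -E -Rintegral_cst//; apply: le_Rintegral => //.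
- have := bounded_integrable_itv (itv_finite true false a b).
  by move=> /integrable_norm.
- apply: (@measurable_bounded_integrable _ _ _ _ (cst C)) => //.
    exact: itv_finite.
  exists `|C|; split; first exact: num_real.
  by move=> M CM t _; exact: ltW.
Qed.

(** Between two consecutive integers the integral varies by at most [C]. *)
Lemma cvg_time_average_of_nat :
  cvg (n%:R^-1 * \int[leb]_(t in `[0, n%:R]) f t @[n --> \oo]) ->
  cvg (T^-1 * \int[leb]_(t in `[0, T]) f t @[T --> +oo]).
Proof.
move=> /cvg_ex[/= L hL]; apply/cvg_ex; exists L.
have C0 : 0 <= C := le_trans (normr_ge0 _) (fC 0).
apply/cvgrPdist_le => e e0.
have e20 : 0 < e / 2 by lra.
have /cvgrPdist_le/(_ _ e20)[N _ hN] := hL.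
pose S := Num.max (N%:R + 1) (4 * C / e + 1).
near=> T.
have TS : S <= T by near: T; apply: nbhs_pinfty_ge; exact: num_real.
have [TN TC] : N%:R + 1 <= T /\ 4 * C / e + 1 <= T.
  by move: TS; rewrite ge_max => /andP.
have N0 : 0 <= N%:R :> R by rewrite ler0n.
have T0 : 0 < T by lra.
pose n := Num.trunc T.
have /andP[nT Tn] := truncn_itv (ltW T0); rewrite -/n in nT Tn.
rewrite -natr1 in Tn.
have Nn : (N <= n)%N by rewrite -ltnS -(ltr_nat R) -[n.+1%:R]natr1; lra.
have n0 : 0 < n%:R :> R.
  rewrite ltr0n lt0n; apply/eqP => n0; move: Tn; rewrite n0; lra.
have := hN n Nn; rewrite /=; set a := \int[leb]_(t in `[0, n%:R]) f t => ha.
have Tsplit : \int[leb]_(t in `[0, T]) f t = a + \int[leb]_(t in `[n%:R, T]) f t.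
  by apply: Rintegral_itvD => //; exact: ltW.
set b := \int[leb]_(t in `[n%:R, T]) f t in Tsplit.
have hb : `|b| <= C.
  apply: le_trans (Rintegral_itv_le nT) _.
  by rewrite ler_piMr//; lra.
have ha' : `|a| <= C * n%:R.
  by have := Rintegral_itv_le (ltW n0); rewrite subr0.
have E : L - T^-1 * (a + b) =
    (L - n%:R^-1 * a) + (n%:R^-1 * a * ((T - n%:R) / T) - T^-1 * b).
  by field; rewrite !gt_eqF.
rewrite Tsplit E (splitr e).
apply: le_trans (ler_normD _ _) _; apply: lerD => //.
apply: le_trans (ler_normB _ _) _.
have h1 : `|n%:R^-1 * a * ((T - n%:R) / T)| <= C / T.
  have hx : `|n%:R^-1 * a| <= C.
    by rewrite normrM gtr0_norm ?invr_gt0// ler_pdivrMl// mulrC.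
  have hy : `|T - n%:R| <= 1 by rewrite ger0_norm; lra.
  have T0' : 0 < T^-1 by rewrite invr_gt0.
  rewrite normrM [X in _ * X]normrM (gtr0_norm T0') mulrA.
  apply: ler_wpM2r; first exact: ltW.
  by apply: le_trans (ler_pM _ _ hx hy) _ => //; rewrite mulr1.
have h2 : `|T^-1 * b| <= C / T.
  by rewrite normrM gtr0_norm ?invr_gt0// mulrC ler_wpM2r// invr_ge0 ltW.
apply: le_trans (lerD h1 h2) _.
rewrite -mulrDl ler_pdivrMr//.
have : 4 * C / e * e <= T * e by rewrite ler_pM2r//; lra.
by rewrite divfK ?gt_eqF//; lra.
Unshelve. all: by end_near. Qed.

End TimeIntegrals.

Section Averages.
Variables (R : realType) (D : bounded_smooth_domain R).
Local Notation Cw := (Cw D).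
Local Notation leb := (@lebesgue_measure R).
Let T2 := (measurableTypeR R * borelCw D)%type.
Variable Phi : H D -> R.
Variable C : R.
Hypothesis Phi_C : forall u, `|Phi u| <= C.
Hypothesis Phi_m : measurable_fun setT (Phi : borelH D -> R).

Lemma measurable_observable : measurable_fun setT (fun z : T2 => Phi (at_time z.2 z.1)).
Proof.
have [e e_dense] := H_separable D.
exact: measurableT_comp Phi_m (measurable_at_time e_dense).
Qed.

Lemma measurable_observable_time (u : Cw) :
  measurable_fun setT (fun t : measurableTypeR R => Phi (at_time u t)).
Proof.
have := measurableT_comp measurable_observable
  (@measurable_pair2 _ _ (measurableTypeR R) (borelCw D) u).
exact.
Qed.

Definition unit_average (u : borelCw D) : R := \int[leb]_(t in `[0, 1]) Phi (at_time u t).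

Lemma unit_average_bounded u : `|unit_average u| <= C.
Proof.
have := @Rintegral_itv_le R (fun t => Phi (at_time u t)) C (measurable_observable_time u)
  (fun t => Phi_C _) 0 1 ler01.
by rewrite subr0 mulr1.
Qed.

(** Adding [C] makes the integrand nonnegative, so that the Fubini-Tonelli theorem
    gives the measurability of the integral in [u]. *)
Lemma measurable_unit_average : measurable_fun setT unit_average.
Proof.
pose I : set (measurableTypeR R) := [set` `[0, 1]].
have mI : measurable I by exact: measurable_itv.
pose f (z : T2) : \bar R := ((Phi (at_time z.2 z.1) + C) * \1_I z.1)%:E.
have f0 z : (0 <= f z)%E.
  rewrite lee_fin mulr_ge0//; have := Phi_C (at_time z.2 z.1).
  by rewrite ler_norml => /andP[+ _]; lra.
have mf : measurable_fun setT f.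
  apply/measurable_EFinP; apply: measurable_funM.
    by apply: measurable_funD => //; exact: measurable_observable.
  apply: (measurableT_comp (measurable_indic mI)).
  exact: measurable_fst.
have mG := @measurable_fun_fubini_tonelli_G _ _
  (measurableTypeR R) (borelCw D) R leb f mf f0.
have -> : unit_average = fun u => fine (fubini_G leb f u) - C.
  apply/funext => u; rewrite /fubini_G /f /=.
  have int1 : leb.-integrable I (EFin \o (fun t => Phi (at_time u t))).
    apply: (bounded_integrable_itv (measurable_observable_time u) (C := C)) => //.
    exact: itv_finite.
  have int2 : leb.-integrable I (EFin \o cst C).
    apply: (bounded_integrable_itv (f := cst C) (C := `|C|)) => //.
    exact: itv_finite.
  rewrite -[fine _]/(\int[leb]_x ((Phi (at_time u x) + C) * \1_I x)).
  have -> : \int[leb]_x ((Phi (at_time u x) + C) * \1_I x) =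
      \int[leb]_(x in I) (Phi (at_time u x) + C).
    rewrite [RHS]Rintegral_mkcond; apply: eq_Rintegral => x _.
    by rewrite patchE indicE; case: ifP => _; rewrite ?mulr1 ?mulr0.
  rewrite RintegralD// Rintegral_cst//.
  have -> : fine (leb I) = 1 by rewrite /I lebesgue_measure_itv/= lte_fin ltr01 oppr0 adde0.
  by rewrite mulr1 addrK.
apply: measurable_funB => //.
by apply: measurableT_comp => //; exact: mG.
Qed.

Lemma at_time_iter_shift i (u : borelCw D) t : 0 <= t ->
  at_time (iter i (Defs.shift 1) u) t = at_time u (t + i%:R).
Proof.
elim: i t => [|i IH] t t0; first by rewrite addr0.
by rewrite iterS at_time_shift// IH ?addr_ge0// -addrA -natr1 [i%:R + 1]addrC.
Qed.

Lemma ergodic_sum_unit_average n (u : borelCw D) :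
  ergodic_sum (Defs.shift 1) unit_average n u =
  \int[leb]_(t in `[0, n%:R]) Phi (at_time u t).
Proof.
have mPhi := measurable_observable_time u.
have bPhi t : `|Phi (at_time u t)| <= C := Phi_C _.
elim: n => [|n IH].
  by rewrite /ergodic_sum big_ord0 set_itv1 Rintegral_set1.
rewrite /ergodic_sum big_ord_recr/= -/(ergodic_sum _ _ _ _) IH.
rewrite (@Rintegral_itvD _ _ _ mPhi bPhi 0 n%:R n.+1%:R)//; last by rewrite ler_nat.
congr (_ + _).
have := @Rintegral_translation _ _ _ mPhi bPhi 0 1 n%:R.
rewrite add0r [1 + _]addrC natr1 => ->.
apply: eq_Rintegral => t; rewrite inE/= in_itv/= => /andP[t0 _].
by rewrite at_time_iter_shift.
Qed.

Variable rho : probability (borelCw D) R.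
Hypothesis rho_inv : forall A : set (borelCw D), measurable A ->
  rho (Defs.shift 1 @^-1` A) = rho A.

(** Over [n] units of time, the ergodic sum of [unit_average] is the integral of
    [Phi (u t)]. *)
Theorem ae_time_average : {ae rho, forall u, time_average_converges Phi u}.
Proof.
have bF : bounded_measurable unit_average.
  by split; [exact: measurable_unit_average|exists C; exact: unit_average_bounded].
have := birkhoff (@measurable_shift R D 1 ler01) rho_inv bF.
apply: filterS => u cu.
apply: (cvg_time_average_of_nat (measurable_observable_time u) (fun t => Phi_C _)).
by under eq_fun do rewrite -ergodic_sum_unit_average.
Qed.

End Averages.

Section LerayHopfBounded.
Variables (R : realType) (D : bounded_smooth_domain R) (nu : R) (f : H D).
Local Notation ipH := (@H_inner R D).
Local Notation normH := (hnorm ipH).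
Local Notation Cw := (Cw D).
Local Notation leb := (@lebesgue_measure R).

(** The norm is weakly lower semicontinuous: exceeding [M] at time [t] would
    force the same on an interval, which is not negligible. *)
Lemma ae_bound_everywhere (u : Cw) (a b M : R) : 0 <= M ->
  {ae leb, forall t, a <= t <= b -> normH (at_time u t) <= M} ->
  forall t, a <= t < b -> normH (at_time u t) <= M.
Proof.
move=> M0 [N [mN N0 hN]] t /andP[at_ tb].
apply: hnorm_le_weak => // v; rewrite leNgt; apply/negP => gt.
pose d := `|ipH (at_time u t) v| - M * normH v.
have d0 : 0 < d by rewrite subr_gt0.
have /cvgrPdist_lt/(_ _ d0)/nbhs_ballP[r /= r0 hr] := @traj_continuous R D u v t.
pose s := Num.min (t + r) b.
have ts : t < s by rewrite lt_min ltrDl r0.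
have sub : [set` `]t, s[] `<=` N.
  move=> x /=; rewrite in_itv/= => /andP[tx xs]; apply: hN => /= h.
  have [xr xb] : x < t + r /\ x < b by move: xs; rewrite lt_min => /andP.
  have xM : normH (at_time u x) <= M by apply: h; lra.
  have := hr x; rewrite /ball/= => /(_ _)/wrap[].
    by rewrite ltr_norml; apply/andP; split; lra.
  have := H_cauchy_schwarz (at_time u x) v.
  have : normH (at_time u x) * normH v <= M * normH v by rewrite ler_wpM2r ?hnorm_ge0.
  have := lerB_dist (ipH (at_time u t) v) (ipH (at_time u x) v).
  rewrite /d; lra.
have : (leb [set` `]t, s[] <= leb N)%E by apply: le_measure; rewrite ?inE.
rewrite N0 lebesgue_measure_itv/= lte_fin ts -EFinB lee_fin subr_le0.
by rewrite leNgt ts.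
Qed.

(** Strong continuity at time 0 from the right bounds the norm near 0; away from
    0 it is locally essentially bounded. *)
Lemma leray_hopf_bounded (u : Cw) n : leray_hopf nu f u ->
  exists j, bounded_traj n j u.
Proof.
move=> [Linf _ _ rc _].
have /cvgrPdist_le/(_ 1 ltr01) := rc.
rewrite near_withinE => -[r /= r0 hr].
have near0 t : 0 <= t < r -> normH (at_time u t) <= normH (at_time u 0) + 1.
  move=> /andP[t0 tr].
  have [->|tn0] := eqVneq t 0; first by rewrite lerDl.
  have tp : 0 < t by rewrite lt_neqAle eq_sym tn0.
  have := hr t; rewrite /ball/= sub0r normrN ger0_norm// => /(_ tr tp).
  rewrite sub0r normrN L2_distE ger0_norm ?sqrtr_ge0// => h.
  apply: le_trans (hnorm_sub_le (at_time u 0) _) _.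
  by rewrite lerD2l H_sqdistC.
have r20 : 0 < r / 2 by lra.
have [M hM] := Linf (r / 2) n.+1%:R r20.
pose M' := Num.max M 0.
have hM' : {ae leb, forall t, r / 2 <= t <= n.+1%:R -> normH (at_time u t) <= M'}.
  have [N [mN N0 hN]] := hM; exists N; split=> // t nt; apply: hN => h.
  apply: nt => tn; apply: le_trans (h tn) _.
  by rewrite le_max lexx.
have M'0 : 0 <= M' by rewrite le_max lexx orbT.
have far := ae_bound_everywhere M'0 hM'.
pose B := Num.max M' (normH (at_time u 0) + 1).
exists (Num.trunc B).+1 => t /andP[t0 tn].
apply: le_trans (ltW (truncnS_gt B)); rewrite /B le_max.
have [tr|tr] := ltP t (r / 2).
  by rewrite near0 ?orbT// t0/=; lra.
by rewrite far// tr/= (le_lt_trans tn)// ltr_nat.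
Qed.

End LerayHopfBounded.

(** * Initial values of almost all trajectories *)

Section Image.
Variables (R : realType) (D : bounded_smooth_domain R).
Variable rho : probability (borelCw D) R.
Local Notation Cw := (Cw D).

(** Strong convergence implies weak convergence, so a weakly closed set is closed
    for the norm. *)
Lemma weakly_closed_measurable (A : set (Hw D)) :
  closed A -> measurable (A : set (borelH D)).
Proof.
move=> cA; rewrite -(setCK A); apply: measurableC; apply: sub_sigma_algebra.
move=> u nAu; have oA := closed_openC cA.
have : nbhs (u : Hw D) (~` A) by exact: open_nbhs_nbhs.
apply: contraPP => noball.
have /choice[w hw] (n : nat) : exists w : H D, L2_dist u w < n.+1%:R^-1 /\ A w.
  apply: contrapT => h; apply: noball; exists n.+1%:R^-1; first by rewrite invr_gt0.
  by move=> w uw Aw; apply: h; exists w.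
have wu : (w n : Hw D) @[n --> \oo] --> (u : Hw D).
  apply/Hw_cvgP => v.
  apply: (@ip_cvgl _ _ _ _ (@H_innerC R D) (@H_inner_comb R D) (@H_inner_ge0 R D)).
  apply/cvgrPdist_lt => e e0.
  have : \forall n \near \oo, n.+1%:R^-1 < Num.sqrt e.
    have se : 0 < Num.sqrt e by rewrite sqrtr_gt0.
    exists (Num.trunc (Num.sqrt e)^-1) => // n /= hn.
    rewrite -[ltRHS]invrK ltf_pV2 ?posrE ?invr_gt0//.
    by apply: lt_le_trans (truncnS_gt _) _; rewrite ler_nat ltnS.
  apply: filterS => n hn; rewrite sub0r normrN ger0_norm.
    have := lt_trans (hw n).1 hn.
    by rewrite L2_distE ltr_sqrt// H_sqdistC.
  exact: hsqdist_ge0 (@H_innerC R D) (@H_inner_comb R D) (@H_inner_ge0 R D) _ _.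
by move=> /wu[n _ /(_ n (leqnn n))]; apply; exact: (hw n).2.
Qed.

(** Almost all trajectories lie in countably many compact sets of good ones,
    whose initial values form weakly compact, hence Borel, sets. *)
Lemma ae_initial_value (good : set (borelCw D)) :
  (forall n, rho (\bigcap_j ~` bounded_traj n j) = 0%E) ->
  {ae rho, forall u, good u} ->
  {ae stationary_solution rho, forall u0 : H D, exists2 u : Cw, good u & at_time u 0 = u0}.
Proof.
move=> bnd [N [mN N0 hN]].
have [e e_dense] := H_separable D.
have /choice[C hC] (n : nat) : exists C : set Cw, [/\ compact C, C `<=` ~` N &
    (rho (~` N `\` C : set (borelCw D)) < (n.+1%:R^-1)%:E)%E].
  apply: (Cw_inner_compact e_dense bnd); first exact: measurableC.
  by rewrite invr_gt0.
pose K n : set (Hw D) := (fun u : Cw => at_time u 0 : Hw D) @` C n.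
have cK n : closed (K n).
  apply: compact_closed; first exact: Hw_hausdorff.
  apply: continuous_compact; last by case: (hC n).
  by apply: continuous_subspaceT; exact: at_time_continuous.
pose B : set (borelH D) := ~` \bigcup_n K n.
have mB : measurable B.
  apply: measurableC; apply: bigcup_measurable => n _.
  exact: weakly_closed_measurable.
exists B; split=> //.
  rewrite /stationary_solution /pushforward.
  have mK n : measurable (@Pi0 R D @^-1` (K n) : set (borelCw D)).
    apply: closed_measurable.
    suff : closed ((fun u : Cw => at_time u 0 : Hw D) @^-1` K n) by [].
    by apply: closed_comp => [u _|//]; exact: at_time_continuous.
  have mPB : measurable (@Pi0 R D @^-1` B : set (borelCw D)).
    suff : measurable (~` \bigcup_n (@Pi0 R D @^-1` K n) : set (borelCw D)) by [].
    by apply: measurableC; exact: bigcup_measurable.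
  apply/eqP; rewrite eq_le measure_ge0 andbT; apply/lee_addgt0Pr => r r0.
  rewrite add0e.
  pose n := Num.trunc r^-1.
  have nr : n.+1%:R^-1 < r.
    by rewrite -[ltRHS]invrK ltf_pV2 ?posrE ?invr_gt0// truncnS_gt.
  have [cC CN Cr] := hC n.
  have mC : measurable (C n : set (borelCw D)).
    apply: closed_measurable; apply: compact_closed => //.
    exact: (@separated_hausdorff R Cw (sample e)
      (sample_continuous (e := e)) (sample_separates e_dense)).
  apply: (@le_trans _ _ (rho (N `|` (~` N `\` C n)))).
    apply: le_measure; rewrite ?inE//.
      by apply: measurableU => //; apply: measurableD => //; exact: measurableC.
    move=> u hu; have [Nu|nNu] := pselect (N u); [by left|right; split=> // Cu].
    by apply: hu; exists n => //; exists u.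
  apply: le_trans (measureU2 _ _ _) _ => //.
    by apply: measurableD => //; exact: measurableC.
  apply: le_trans (leeD (_ : (rho N <= 0)%E) (ltW Cr)) _; first by rewrite N0.
  by rewrite add0e lee_fin ltW.
move=> u0 /= nu0 [n _ [u Cu uu0]]; apply: nu0; exists u => //.
have [_ CN _] := hC n; apply: contrapT => ngood.
by apply: (CN u Cu); exact: hN.
Qed.

End Image.

Theorem theorem1p1 (R : realType) (Omega : bounded_smooth_domain R)
    (nu : R) (nu_gt0 : 0 < nu) (f : H Omega)
    (rho : probability (borelCw Omega) R)
    (rho_vf : invariant_vishik_fursikov nu f rho)
    (Phi : H Omega -> R)
    (Phi_bounded : exists M : R, forall u, `|Phi u| <= M)
    (Phi_borel : measurable_fun setT (Phi : borelH Omega -> R)) :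
  {ae rho, forall u, leray_hopf nu f u -> time_average_converges Phi u} /\
  {ae stationary_solution rho, forall u0 : H Omega,
    exists u : Cw Omega, [/\ leray_hopf nu f u, at_time u 0 = u0
                           & time_average_converges Phi u]}.
Proof.
have [lh inv] := rho_vf; have [C PhiC] := Phi_bounded.
have avg := ae_time_average PhiC Phi_borel (inv 1 ler01).
have FF : Filter (almost_everywhere rho) := ae_filter_ringOfSetsType rho.
split; first by apply: filterS avg => u ? _.
have bnd n : rho (\bigcap_j ~` bounded_traj n j) = 0%E.
  have [N [mN N0 hN]] := lh.
  apply/eqP; rewrite eq_le measure_ge0 andbT -N0.
  apply: le_measure; rewrite ?inE//.
    apply: bigcap_measurable => // j _; apply: measurableC.
    by apply: closed_measurable; exact: closed_bounded_traj.
  move=> u hu; apply: hN => lhu.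
  by have [j] := leray_hopf_bounded n lhu; exact: hu.
have [B [mB B0 hB]] := ae_initial_value bnd (filterI lh avg).
exists B; split=> // u0 nu0; apply: hB => -[u [lhu avgu] uu0].
by apply: nu0; exists u.
Qed.
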